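(* Let $(S,\mathcal{B})$ be a standard Borel space and let $X=(X_1,X_2,\ldots)$ be a sequence of $S$-valued random variables on a probability space $(\Omega,\mathcal{A},P)$, with predictive distributions $\alpha_n$, $n\ge 0$, and empirical measures $\mu_n=\frac{1}{n}\sum_{i=1}^n\delta_{X_i}$, $n\ge 1$. Then the following two conditions are equivalent: (a) for each $f\in M_b(S)$, the sequence $\alpha_n(f)$ converges in probability as $n\to\infty$; (b) $\lim_n P(X_n\in B)$ exists for every $B\in\mathcal{B}$ and, for all $f\in C_b(S)$ and all $H\in\mathcal{A}$ with $P(H)>0$: $\lim_n E\{f(X_n)\mid H\}$ exists, $\mu_n(f)$ converges in probability as $n\to\infty$, and $$\lim_n E\bigl\{\alpha_n(f)^2-\mu_n(f)^2\bigr\}=0.$$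
   Context: A standard Borel space $(S,\mathcal{B})$ here means that $S$ is a Borel subset of some Polish space and $\mathcal{B}$ is the Borel $\sigma$-field on $S$. $M_b(S)$ is the set of real bounded $\mathcal{B}$-measurable functions on $S$ and $C_b(S)$ the set of real bounded continuous functions on $S$. Set $\mathcal{F}_0=\{\emptyset,\Omega\}$ and $\mathcal{F}_n=\sigma(X_1,\ldots,X_n)$ for $n\ge 1$. $\delta_x$ denotes the unit mass at $x\in S$, so $\mu_n(f)=\frac1n\sum_{i=1}^n f(X_i)$. For $H\in\mathcal{A}$ with $P(H)>0$ and a bounded random variable $Y$, $E\{Y\mid H\}=E\{1_H Y\}/P(H)$. A random probability measure on $\mathcal{B}$ is a map $\alpha$ on $\Omega\times\mathcal{B}$ such that $\alpha(\omega,\cdot)$ is a probability measure on $\mathcal{B}$ for each fixed $\omega\in\Omega$, and $\omega\mapsto\alpha(\omega,B)$ is $\mathcal{A}$-measurable for each fixed $B\in\mathcal{B}$. For $f\in M_b(S)$, $\alpha(f)$ denotes the real random variable $\omega\mapsto\int f(x)\,\alpha(\omega,dx)$. The predictive distributions of $X$ are the random probability measures $\alpha_n(\cdot)=P(X_{n+1}\in\cdot\mid\mathcal{F}_n)$, $n\ge 0$ (regular conditional distributions), so that $\alpha_n(f)=E\{f(X_{n+1})\mid\mathcal{F}_n\}$ a.s. for each $f\in M_b(S)$. *)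

(* Defs.v *)
From HB Require Import structures.
From mathcomp Require Import all_boot all_order all_algebra.
From mathcomp Require Import all_classical all_reals all_analysis measurable_realfun.

Set Implicit Arguments.
Unset Strict Implicit.
Unset Printing Implicit Defensive.

Import Order.TTheory GRing.Theory Num.Theory.
Import numFieldNormedType.Exports.

Local Open Scope classical_set_scope.
Local Open Scope ring_scope.

Definition homeomorphic (T U : topologicalType) : Prop :=
  exists (f : T -> U) (g : U -> T),
    [/\ cancel f g, cancel g f, continuous f & continuous g].

Definition separable (T : topologicalType) : Prop :=
  exists2 D : set T, countable D & dense D.

Definition complete_metric (R : realType) (M : metricType R) : Prop :=
  forall F : set_system M, ProperFilter F -> cauchy F -> exists x : M, F --> x.

Definition polish (R : realType) (T : topologicalType) : Prop :=
  exists M : metricType R,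
    [/\ complete_metric M, separable M & homeomorphic T M].

(* A Borel subset of a Polish space is represented by a type [S] of its own,
   carrying the relative topology; [A] below is coerced to the subtype
   [set_type A], whose topology is the one induced by [T].  Nonemptiness of
   [S] (required by [measurableType]) is no restriction, as [S] is the target
   of random variables. *)
Definition standard_borel (R : realType) (S : topologicalType) : Prop :=
  exists (T : topologicalType) (A : set T),
    [/\ polish R T, <<s @open T >> A & homeomorphic S A].

Notation borelType S := (g_sigma_algebraType (@open S)).

Definition Mb (R : realType) (S : ptopologicalType) : set (S -> R) :=
  [set f | measurable_fun [set: borelType S] (f : borelType S -> R) /\
           [bounded f x | x in [set: S]]].

Definition Cb (R : realType) (S : ptopologicalType) : set (S -> R) :=
  [set f | continuous f /\ [bounded f x | x in [set: S]]].

Section RandomMeasures.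
Context {d : measure_display} {Omega : measurableType d} {R : realType}.
Context (P : probability Omega R).

Definition cvg_in_probability (Y : nat -> Omega -> R) : Prop :=
  exists Z : {RV P >-> R}, forall e : R, 0 < e ->
    P [set w | e < `|Y n w - Z w|] @[n --> \oo] --> 0%E.

Definition cond_expectation (H : set Omega) (Y : Omega -> R) : R :=
  fine 'E_P[fun w => \1_H w * Y w] / fine (P H).

Context {S : ptopologicalType}.

Definition random_integral
    (alpha : Omega -> {measure set (borelType S) -> \bar R}) (f : S -> R) :
    Omega -> R :=
  fun w => \int[alpha w]_x (f : borelType S -> R) x.

(* Sequences are indexed from 0: [X i] stands for $X_{i+1}$.  Hence $F_n$ is
   generated by [X 0, ..., X n.-1], and $\alpha_n$ predicts [X n]. *)
Context (X : nat -> {mfun Omega >-> borelType S}).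

Definition past (n : nat) : set (set Omega) :=
  <<s \bigcup_(i in `I_n) preimage_set_system [set: Omega] (X i) measurable >>.

(* [alpha n] is a regular version of $P(X_{n+1} \in \cdot \mid F_n)$. *)
Definition predictive (alpha : nat -> R.-pker Omega ~> borelType S) : Prop :=
  forall (n : nat) (B : set (borelType S)), measurable B ->
    measurable_fun [set: g_sigma_algebraType (past n)]
      (fun w : g_sigma_algebraType (past n) => alpha n w B) /\
    forall H : set Omega, past n H ->
      (\int[P]_(w in H) alpha n w B = P (H `&` X n @^-1` B))%E.

Definition empirical (n : nat) (w : Omega) :
    {measure set (borelType S) -> \bar R} :=
  mscale (n%:R^-1)%:nng (msum (fun i => \d_(X i w)) n).

End RandomMeasures.

(* Main.v *)
(** The innovations [Y n = f (X n) - alpha_n f] are bounded and orthogonal to the past, so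
    Bessel's inequality gives [E (Z * Y n) --> 0] for every bounded [Z], and the means of
    the [Y i] vanish in L2.  Hence if [alpha_n f --> V] in probability (equivalently in L1,
    all variables being uniformly bounded), then [E (1_H * f (X n)) --> E (1_H * V)], and
    the empirical means, being Cesaro means of the [alpha_i f] up to the vanishing means of
    the [Y i], tend to [V] in L1.

    Conversely, let [f] be continuous and bounded and let [V] be the limit of the empirical
    means.  The Cesaro means of [E (1_H * f (X n))] tend to [E (1_H * V)], so this sequence
    does as well; by Bessel, [E (V * alpha_n f) --> E (V ^+ 2)], while
    [E ((alpha_n f) ^+ 2) --> E (V ^+ 2)] by assumption; expanding the square,
    [alpha_n f --> V] in L2.  To reach an indicator [1_B], note that by Nikodym's theorem
    the laws of the [X n] have uniformly small tails along sets decreasing to the empty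
    set; so the sets [B] for which [1_B (X n)] is L1-close to some [f (X n)] with [f]
    continuous, uniformly for large [n], form a sigma-algebra containing the open sets, and
    [alpha_n 1_B] is Cauchy in L1.  Only the metrizability of [S] is used. *)

Require Import Defs.
From HB Require Import structures.
From mathcomp Require Import all_boot all_order all_algebra.
From mathcomp Require Import all_classical all_reals all_analysis measurable_realfun.
From mathcomp Require Import ring lra.

Import Order.TTheory GRing.Theory Num.Theory.
Import numFieldNormedType.Exports.

Local Open Scope classical_set_scope.
Local Open Scope ring_scope.

Set Implicit Arguments.
Unset Strict Implicit.
Unset Printing Implicit Defensive.

(** * Bounded measurable functions *)

Section BoundedMeasurable.
Context {d : measure_display} {T : measurableType d} {R : realType}.
Implicit Types f g : T -> R.

(** The bound holds at every point, so these functions form an algebra closed under uniform limits,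
    and they are integrable against every finite measure. *)
Definition bmf f := measurable_fun [set: T] f /\ exists M, forall x, `|f x| <= M.

Lemma bmf_measurable f : bmf f -> measurable_fun [set: T] f.
Proof. by case. Qed.

Lemma bmf_bound f : bmf f -> exists2 M, 0 < M & forall x, `|f x| <= M.
Proof.
move=> [_ [M fM]]; exists (`|M| + 1); first by rewrite ltr_pwDr.
move=> x; apply: le_trans (fM x) _; apply: le_trans (ler_norm M) _.
by rewrite lerDl.
Qed.

Lemma bmf_cst a : bmf (fun=> a).
Proof. by split; [exact: measurable_cst | exists `|a|]. Qed.

Lemma bmfD f g : bmf f -> bmf g -> bmf (fun x => f x + g x).
Proof.
move=> [mf [M fM]] [mg [N gN]]; split; first exact: measurable_funD.
by exists (M + N) => x; rewrite (le_trans (ler_normD _ _))// lerD.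
Qed.

Lemma bmfM f g : bmf f -> bmf g -> bmf (fun x => f x * g x).
Proof.
move=> [mf [M fM]] [mg [N gN]]; split; first exact: measurable_funM.
by exists (M * N) => x; rewrite normrM ler_pM.
Qed.

Lemma bmfN f : bmf f -> bmf (fun x => - f x).
Proof.
move=> [mf [M fM]]; split; first exact: measurable_funN.
by exists M => x; rewrite normrN.
Qed.

Lemma bmfB f g : bmf f -> bmf g -> bmf (fun x => f x - g x).
Proof. by move=> bf bg; apply: bmfD => //; exact: bmfN. Qed.

Lemma bmfZ a f : bmf f -> bmf (fun x => a * f x).
Proof. exact/bmfM/bmf_cst. Qed.

Lemma bmfX f n : bmf f -> bmf (fun x => f x ^+ n).
Proof.
move=> bf; elim: n => [|n IH]; first exact: bmf_cst.
by under eq_fun do rewrite exprS; exact: bmfM.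
Qed.

Lemma bmf_norm f : bmf f -> bmf (fun x => `|f x|).
Proof.
move=> [mf [M fM]]; split; first exact: measurableT_comp.
by exists M => x; rewrite normr_id.
Qed.

Lemma bmf_sum (I : Type) (r : seq I) (F : I -> T -> R) :
  (forall i, bmf (F i)) -> bmf (fun x => \sum_(i <- r) F i x).
Proof.
move=> bF; elim: r => [|i r IH].
  by under eq_fun do rewrite big_nil; exact: bmf_cst.
by under eq_fun do rewrite big_cons; exact: bmfD.
Qed.

Lemma bmf_indic (A : set T) : measurable A -> bmf (\1_A : T -> R).
Proof.
move=> mA; split; first exact: measurable_indic.
by exists 1 => x; rewrite indicE; case: (_ \in _); rewrite ?normr1 ?normr0.
Qed.

(** Linear combinations of indicators are uniformly dense in the bounded measurable functions. The
    principle is used over the Borel sets of [S], over all events and over the past events alike. *)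
Lemma bmf_ind (Q : (T -> R) -> Prop) :
  (forall A, measurable A -> Q (\1_A)) ->
  (forall a f g, bmf f -> bmf g -> Q f -> Q g -> Q (fun x => a * f x + g x)) ->
  (forall f, bmf f -> (forall e, 0 < e ->
     exists g, [/\ bmf g, Q g & forall x, `|f x - g x| <= e]) -> Q f) ->
  forall f, bmf f -> Q f.
Proof.
move=> Q1 QD Qlim f bf.
have Q0 : Q (fun=> 0).
  rewrite (_ : (fun=> _) = \1_set0); first exact: Q1.
  by apply/funext => x; rewrite indicE in_set0.
(* Peel off [e * \1_(e <= h)] one level at a time. *)
have step e n h : 0 < e -> bmf h -> (forall x, 0 <= h x <= n.+1%:R * e) ->
    exists g, [/\ bmf g, Q g & forall x, `|h x - g x| <= e].
  move=> e0; elim: n h => [|n IH] h bh hn.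
    exists (fun=> 0); split => //; first exact: bmf_cst.
    by move=> x; rewrite subr0; have /andP[h0 h1] := hn x; rewrite ger0_norm// -(mul1r e).
  pose A := [set x | e <= h x].
  have mA : measurable A.
    have mle : measurable_fun [set: T] (fun x => e <= h x).
      by apply: measurable_fun_ler; [exact: measurable_cst | case: bh].
    by rewrite -[A]setTI; exact: (mle measurableT [set true]).
  have b1 := bmf_indic mA.
  pose k x := h x - e * \1_A x.
  have bk : bmf k by apply: bmfB => //; exact: bmfZ.
  have [x|g [bg Qg gk]] := IH k bk.
    have := hn x; rewrite /k indicE; have [/set_mem/= xA|/negP xA] := boolP (x \in A).
      move=> /andP[_ hx]; rewrite mulr1 subr_ge0 xA/= lerBlDr.
      by move: hx; rewrite -[n.+2]addn1 natrD mulrDl mul1r.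
    move=> /andP[hx0 _]; rewrite mulr0 subr0 hx0/=.
    have : h x < e by rewrite ltNge; apply/negP => hx; apply: xA; exact/mem_set.
    move=> /ltW/le_trans; apply; rewrite ler_peMl//; first exact: ltW.
    by rewrite ler1n.
  exists (fun x => e * \1_A x + g x); split.
  - by apply: bmfD => //; exact: bmfZ.
  - by apply: QD => //; exact: Q1.
  - by move=> x; rewrite opprD addrA; exact: gk.
have [M M0 fM] := bmf_bound bf.
apply: Qlim => // e e0.
have bfM : bmf (fun x => M + f x) by apply: bmfD => //; exact: bmf_cst.
(* Adding [M] makes the function nonnegative and at most [M + M], a range that the chosen number of
   levels of height [e] covers. The shift is undone below with the indicator of the whole space. *)
have [x|g [bg Qg gf]] := step e (Num.truncn ((M + M) / e)) _ e0 bfM.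
  have := fM x; rewrite ler_norml => /andP[fx1 fx2].
  rewrite -lerBlDl sub0r fx1/= -ler_pdivrMr//.
  apply: ltW; apply: le_lt_trans (truncnS_gt _).
  by rewrite ler_pM2r ?invr_gt0// lerD2l.
exists (fun x => - M * \1_[set: T] x + g x); split.
- by apply: bmfD => //; apply: bmfZ; exact: bmf_indic.
- by apply: QD => //; [exact: bmf_indic | exact: Q1].
- move=> x; rewrite indicE in_setT mulr1 opprD opprK addrA [f x + M]addrC.
  exact: gf.
Qed.

End BoundedMeasurable.

Lemma bmf_comp {d d' : measure_display} {T : measurableType d}
    {U : measurableType d'} {R : realType} (f : U -> R) (g : T -> U) :
  measurable_fun [set: T] g -> bmf f -> bmf (fun x => f (g x)).
Proof.
move=> mg [mf [M fM]]; split; first exact: measurableT_comp.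
by exists M => x.
Qed.

(** * Integration of bounded functions against a finite measure *)

Section BoundedIntegral.
Context {d : measure_display} {T : measurableType d} {R : realType}.
Variable mu : {measure set T -> \bar R}.
Hypothesis mufin : (mu [set: T] < +oo)%E.
Implicit Types f g : T -> R.

Lemma bmf_integrable f : bmf f -> mu.-integrable [set: T] (EFin \o f).
Proof.
move=> [mf [M fM]]; apply: measurable_bounded_integrable => //.
by exists M; split; [exact: num_real | move=> N MN x _; exact: le_trans (fM x) (ltW MN)].
Qed.

Lemma bmf_integralE f : bmf f -> (\int[mu]_x (f x)%:E = (\int[mu]_x f x)%R%:E)%E.
Proof. by move=> bf; rewrite fineK//; apply: integrable_fin_num (bmf_integrable bf). Qed.

Lemma bmf_integralD f g : bmf f -> bmf g ->
  \int[mu]_x (f x + g x) = \int[mu]_x f x + \int[mu]_x g x.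
Proof. by move=> bf bg; apply: RintegralD => //; exact: bmf_integrable. Qed.

Lemma bmf_integralB f g : bmf f -> bmf g ->
  \int[mu]_x (f x - g x) = \int[mu]_x f x - \int[mu]_x g x.
Proof. by move=> bf bg; apply: RintegralB => //; exact: bmf_integrable. Qed.

Lemma bmf_integralZ a f : bmf f -> \int[mu]_x (a * f x) = a * \int[mu]_x f x.
Proof. by move=> bf; apply: RintegralZl => //; exact: bmf_integrable. Qed.

Lemma bmf_le_integral f g : bmf f -> bmf g -> (forall x, f x <= g x) ->
  \int[mu]_x f x <= \int[mu]_x g x.
Proof. by move=> bf bg fg; apply: le_Rintegral => //; exact: bmf_integrable. Qed.

Lemma bmf_le_norm_integral f : bmf f -> `|\int[mu]_x f x| <= \int[mu]_x `|f x|.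
Proof. by move=> bf; apply: le_normr_Rintegral => //; exact: bmf_integrable. Qed.

Lemma integral_indic_fine (A : set T) : measurable A ->
  \int[mu]_x (\1_A x : R) = fine (mu A).
Proof. by move=> mA; rewrite /Rintegral integral_indic// setIT. Qed.

Lemma bmf_integral_sum (I : Type) (r : seq I) (F : I -> T -> R) :
  (forall i, bmf (F i)) ->
  \int[mu]_x (\sum_(i <- r) F i x) = \sum_(i <- r) \int[mu]_x F i x.
Proof.
move=> bF; elim: r => [|i r IH].
  rewrite big_nil; under eq_Rintegral do rewrite big_nil.
  by rewrite Rintegral_cst// mul0r.
rewrite big_cons -IH -bmf_integralD//; last exact: bmf_sum.
by under eq_Rintegral do rewrite big_cons.
Qed.

End BoundedIntegral.

(** * Orthogonal sequences and L1 convergence *)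

(** Clipping moves [z] to the nearest point of the interval from [- C] to [C], which contains
    [y]. *)
Lemma clip_dist {R : realDomainType} (C y z : R) : `|y| <= C ->
  `|y - Num.max (- C) (Num.min C z)| <= `|y - z|.
Proof.
rewrite ler_norml => /andP[y1 y2].
have [Cz|zC] := leP C z.
  rewrite max_r; last by rewrite (le_trans y1).
  by rewrite distrC [leRHS]distrC !ger0_norm ?subr_ge0 ?lerD2r// (le_trans y2).
have [Cz|zC'] := leP (- C) z; first by [].
by rewrite !ger0_norm ?subr_ge0 ?lerD2l ?lerN2 ?(ltW zC')// (le_trans (ltW zC')).
Qed.

Section RandomVariables.
Context {d : measure_display} {Omega : measurableType d} {R : realType}.
Variable P : probability Omega R.
Implicit Types (V W Z : Omega -> R) (Y : nat -> Omega -> R).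

Lemma probability_setT_lty : (P [set: Omega] < +oo)%E.
Proof. by rewrite probability_setT ltry. Qed.
Let Pfin := probability_setT_lty.

Lemma bmf_expectationE V : bmf V -> 'E_P[V]%E = (\int[P]_w V w)%:E.
Proof. by move=> bV; rewrite unlock bmf_integralE. Qed.

Lemma integral_cst_prob (a : R) : \int[P]_w a = a.
Proof.
rewrite Rintegral_cst//.
by have P1 : fine (P [set: Omega]) = 1 by [rewrite probability_setT]; rewrite -[RHS]mulr1 -P1.
Qed.

(** * Bessel's inequality for uniformly bounded orthogonal sequences *)

Section Orthogonal.
Variables (Y : nat -> Omega -> R) (C : R).
Hypotheses (C0 : 0 < C) (bY : forall n, bmf (Y n)).
Hypothesis YC : forall n w, `|Y n w| <= C.
Hypothesis orth : forall m n, (m < n)%N -> \int[P]_w (Y m w * Y n w) = 0.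

Let sqrY n : \int[P]_w (Y n w ^+ 2) <= C ^+ 2.
Proof.
rewrite -[leRHS]integral_cst_prob; apply: bmf_le_integral => //.
- exact: bmfX.
- exact: bmf_cst.
- move=> w; rewrite -real_normK ?num_real//.
  by rewrite lerXn2r// nnegrE ltW.
Qed.

Let orth_sum (c : nat -> R) N n : (N <= n)%N ->
  \int[P]_w ((\sum_(i < N) c i * Y i w) * Y n w) = 0.
Proof.
move=> Nn; under eq_Rintegral do rewrite mulr_suml.
rewrite bmf_integral_sum//; last by move=> i; apply: bmfM => //; exact: bmfZ.
rewrite big1// => i _; under eq_Rintegral do rewrite -mulrA.
rewrite bmf_integralZ//; last exact: bmfM.
by rewrite orth ?mulr0//; exact: leq_trans (ltn_ord i) Nn.
Qed.

Lemma orthogonal_sum_sqr N : \int[P]_w ((\sum_(i < N) Y i w) ^+ 2) <= N%:R * C ^+ 2.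
Proof.
elim: N => [|N IH].
  by under eq_Rintegral do rewrite big_ord0 expr0n/=; rewrite integral_cst_prob mul0r.
under eq_Rintegral do rewrite big_ord_recr/= sqrrD -mulr_natl.
have bS : bmf (fun w => \sum_(i < N) Y i w) by exact: bmf_sum.
rewrite !bmf_integralD//; try by [exact: bmfX | apply: bmfZ; exact: bmfM |
  apply: bmfD; [exact: bmfX | apply: bmfZ; exact: bmfM]].
rewrite bmf_integralZ//; last exact: bmfM.
have := @orth_sum (fun=> 1) N N (leqnn N).
under eq_Rintegral do under eq_bigr do rewrite mul1r.
move=> ->; rewrite mulr0 addr0 -[N.+1]addn1 natrD mulrDl mul1r.
exact: lerD.
Qed.

(** The [Y i] are not normalised and may vanish, so the projection uses the common factor
    [t = C ^- 2] in place of the inverses of the second moments. Each subtracted term still lowers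
    the second moment of the remainder [D] by at least [t * c i ^+ 2]. *)
Let bessel_le (Z : Omega -> R) (bZ : bmf Z) N :
  \sum_(i < N) (\int[P]_w (Z w * Y i w)) ^+ 2 <= C ^+ 2 * \int[P]_w (Z w ^+ 2).
Proof.
pose c i := \int[P]_w (Z w * Y i w).
pose t := (C ^+ 2)^-1.
have t0 : 0 < t by rewrite invr_gt0 exprn_gt0.
have C2 : C ^+ 2 = t^-1 by rewrite invrK.
pose D N w := Z w - t * \sum_(i < N) c i * Y i w.
have bS n : bmf (fun w => \sum_(i < n) c i * Y i w).
  by apply: bmf_sum => i; exact: bmfZ.
have bD n : bmf (D n) by apply: bmfB => //; exact: bmfZ.
suff : \int[P]_w (D N w ^+ 2) <= \int[P]_w (Z w ^+ 2) - t * \sum_(i < N) c i ^+ 2.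
  have : 0 <= \int[P]_w (D N w ^+ 2) by apply: Rintegral_ge0 => w _; exact: sqr_ge0.
  move=> /le_trans h /h; rewrite subr_ge0 C2 => h'.
  by rewrite -(ler_pM2l t0) mulVKf// gt_eqF.
elim: N => [|N IH].
  rewrite big_ord0 mulr0 subr0; apply: bmf_le_integral => //; try exact: bmfX.
  by move=> w; rewrite /D big_ord0 mulr0 subr0.
(* Expansion of the square of [D N.+1 = D N - t * c N * Y N]; by orthogonality the cross term only
   sees [Z], and its integral is [c N]. *)
have -> : \int[P]_w (D N.+1 w ^+ 2) = \int[P]_w (D N w ^+ 2)
    + ((- 2 * t * c N) * (\int[P]_w (D N w * Y N w))
       + (t * c N) ^+ 2 * \int[P]_w (Y N w ^+ 2)).
  have b1 := bmfX 2 (bD N); have b2 := bmfM (bD N) (bY N); have b3 := bmfX 2 (bY N).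
  have b4 := bmfZ (- 2 * t * c N) b2; have b5 := bmfZ ((t * c N) ^+ 2) b3.
  rewrite -(bmf_integralZ Pfin _ b2) -(bmf_integralZ Pfin _ b3).
  rewrite -(bmf_integralD Pfin b4 b5) -(bmf_integralD Pfin b1 (bmfD b4 b5)).
  by apply: eq_Rintegral => w _; rewrite /D big_ord_recr/=; ring.
have -> : \int[P]_w (D N w * Y N w) = c N.
  transitivity (\int[P]_w (Z w * Y N w - t * ((\sum_(i < N) c i * Y i w) * Y N w))).
    by apply: eq_Rintegral => w _; rewrite /D; ring.
  have b1 := bmfM bZ (bY N); have b2 := bmfM (bS N) (bY N).
  rewrite bmf_integralB//; last exact: bmfZ.
  by rewrite bmf_integralZ// orth_sum// mulr0 subr0.
rewrite big_ord_recr/= mulrDr.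
set s := \sum_(i < N) _ in IH *; set x := \int[P]_w (D N w ^+ 2) in IH *.
have := sqrY N; set y := \int[P]_w (Y N w ^+ 2) => yC.
(* Because [t * y <= 1], the quadratic term gives back at most half of the decrease
   [2 * (t * c N ^+ 2)] coming from the cross term. *)
have h : (t * c N) ^+ 2 * y <= t * c N ^+ 2.
  have ty : t * y <= 1 by apply: le_trans (ler_wpM2l (ltW t0) yC) _; rewrite C2 mulfV ?gt_eqF.
  have -> : (t * c N) ^+ 2 * y = (t * c N ^+ 2) * (t * y) by ring.
  by rewrite ler_piMr// mulr_ge0 ?sqr_ge0// ltW.
have -> : - 2 * t * c N * c N = - 2 * (t * c N ^+ 2) by ring.
lra.
Qed.

(** The squared coefficients have bounded partial sums, hence form a convergent series, and its
    terms tend to 0. *)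
Lemma bessel_cvg0 Z : bmf Z -> (fun n => \int[P]_w (Z w * Y n w)) @ \oo --> 0.
Proof.
move=> bZ; pose u n := (\int[P]_w (Z w * Y n w)) ^+ 2.
have u0 : u @ \oo --> 0.
  apply: cvg_series_cvg_0; apply: nondecreasing_is_cvgn.
    by apply: nondecreasing_series => n _ _; exact: sqr_ge0.
  exists (C ^+ 2 * \int[P]_w (Z w ^+ 2)) => _ [N _ <-].
  by rewrite /series/= big_mkord; exact: bessel_le.
apply/cvgrPdist_lt => e e0.
move/cvgrPdist_lt : u0 => /(_ (e ^+ 2) (exprn_gt0 _ e0)).
apply: filterS => n; rewrite !sub0r !normrN /u normrX.
by rewrite ltr_pXn2r// ?nnegrE// ltW.
Qed.

End Orthogonal.

(** The real-valued integral sends an infinite value to 0, so this is L1 convergence only for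
    integrable differences; it is applied to [bmf] variables. *)
Definition cvg_L1 Y V := (fun n => \int[P]_w `|Y n w - V w|) @ \oo --> 0.

Lemma cvg_L1_ub Y V : (forall n, bmf (Y n)) -> bmf V ->
  (forall e, 0 < e -> \forall n \near \oo, \int[P]_w `|Y n w - V w| <= e) -> cvg_L1 Y V.
Proof.
move=> bY bV H; apply/cvgrPdist_le => e e0; near=> n.
rewrite sub0r normrN ger0_norm; last by apply: Rintegral_ge0.
by near: n; exact: H.
Unshelve. all: by end_near. Qed.

Lemma cvg_L1_near Y V e : cvg_L1 Y V -> 0 < e ->
  \forall n \near \oo, \int[P]_w `|Y n w - V w| <= e.
Proof.
move=> /cvgrPdist_le h e0; near=> n.
have /(_ n) : forall n, `|0 - \int[P]_w `|Y n w - V w| | = \int[P]_w `|Y n w - V w|.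
  by move=> k; rewrite sub0r normrN ger0_norm//; apply: Rintegral_ge0.
by move=> <-; near: n; exact: h.
Unshelve. all: by end_near. Qed.

Lemma measurable_gt_norm V e : bmf V -> measurable [set w | e < `|V w|].
Proof.
move=> bV.
have mlt : measurable_fun [set: Omega] (fun w => e < `|V w|).
  apply: measurable_fun_ltr; first exact: measurable_cst.
  exact: bmf_measurable (bmf_norm bV).
by rewrite -[X in measurable X]setTI; exact: (mlt measurableT [set true]).
Qed.

Lemma markov_L1 V e : bmf V -> 0 < e ->
  e * fine (P [set w | e < `|V w|]) <= \int[P]_w `|V w|.
Proof.
move=> bV e0; have mA := measurable_gt_norm e bV.
have b1 := @bmf_indic _ _ R _ mA.
rewrite -(integral_indic_fine P mA) -(bmf_integralZ Pfin _ b1).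
apply: bmf_le_integral => //; [exact: bmfZ|exact: bmf_norm|].
move=> w; rewrite indicE; case: (boolP (_ \in _)) => [/set_mem/= /ltW|_]; rewrite ?mulr1 ?mulr0//.
Qed.

Lemma cvg_L1_prob Y V : (forall n, bmf (Y n)) -> bmf V -> cvg_L1 Y V ->
  cvg_in_probability P Y.
Proof.
move=> bY bV YV.
pose Z : {RV P >-> R} := HB.pack_for {mfun Omega >-> R} V
  (isMeasurableFun.Build _ _ _ _ V (bmf_measurable bV)).
exists Z => e e0.
have mA n : measurable [set w | e < `|Y n w - V w|].
  exact: measurable_gt_norm (bmfB (bY n) bV).
rewrite (_ : (fun n => _) = (fun n => (fine (P [set w | e < `|Y n w - V w|]))%:E)); last first.
  by apply/funext => n; rewrite fineK// fin_num_measure.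
apply: cvg_EFin; first by near=> n.
apply/cvgrPdist_le => h h0; near=> n.
rewrite sub0r normrN ger0_norm/= ?fine_ge0//.
rewrite -(ler_pM2l e0); apply: le_trans (markov_L1 _ e0) _; first exact: bmfB.
by near: n; apply: cvg_L1_near => //; exact: mulr_gt0.
Unshelve. all: by end_near. Qed.

(** The given limit is merely measurable, so it is replaced by its clipped version, which is bounded
    everywhere. Bounded convergence then follows by splitting according to whether the deviation
    exceeds [e / 2]. *)
Lemma cvg_prob_L1 Y C : (forall n, bmf (Y n)) -> (forall n w, `|Y n w| <= C) ->
  cvg_in_probability P Y ->
  exists V, [/\ bmf V, forall w, `|V w| <= C & cvg_L1 Y V].
Proof.
move=> bY YC [Z YZ].
have w0 : Omega := point.
have C0 : 0 <= C by apply: le_trans (YC 0%N w0).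
(* Clipping at [C] is 1-Lipschitz and fixes every [Y n]. *)
pose V w := Num.max (- C) (Num.min C (Z w)).
have VC w : `|V w| <= C.
  rewrite /V ler_norml le_max lexx/= ge_max ge_min lexx/=.
  by rewrite (le_trans _ C0)// oppr_le0.
have bV : bmf V.
  split; last by exists C.
  apply: measurable_maxr; first exact: measurable_cst.
  by apply: measurable_minr; first exact: measurable_cst.
exists V; split => //; apply: cvg_L1_ub => // e e0.
have e2 : 0 < e / 2 by rewrite divr_gt0.
(* The added 1 keeps the divisor positive when [C = 0]. *)
have C1 : 0 < C + C + 1 by rewrite ltr_wpDl// addr_ge0.
have := YZ _ e2; move=> /fine_cvg /cvgrPdist_le.
move=> /(_ (e / 2 / (C + C + 1))) h.
near=> n.
have mA : measurable [set w | e / 2 < `|Y n w - V w|].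
  by apply: measurable_gt_norm; exact: bmfB.
have le1 : fine (P [set w | e / 2 < `|Y n w - V w|]) <= e / 2 / (C + C + 1).
  have : `|0 - fine (P [set w | e / 2 < `|Y n w - Z w|])| <= e / 2 / (C + C + 1).
    by near: n; apply: h; rewrite divr_gt0.
  have mB : measurable [set w | e / 2 < `|Y n w - Z w|].
    have mlt : measurable_fun [set: Omega] (fun w => e / 2 < `|Y n w - Z w|).
      apply: measurable_fun_ltr; first exact: measurable_cst.
      apply: measurableT_comp => //; apply: measurable_funB => //.
      exact: bmf_measurable.
    by rewrite -[X in measurable X]setTI; exact: (mlt measurableT [set true]).
  rewrite sub0r normrN ger0_norm ?fine_ge0//; apply: le_trans.
  apply: fine_le; rewrite ?fin_num_measure//.
  apply: le_measure; rewrite ?inE//.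
  move=> w/= /lt_le_trans; apply.
  exact: clip_dist.
(* The deviation is at most [C + C] on the exceptional event and at most [e / 2] off it. *)
apply: (@le_trans _ _ (\int[P]_w (e / 2 + (C + C) * \1_[set w | e / 2 < `|Y n w - V w|] w))).
  have b1 := @bmf_indic _ _ R _ mA.
  apply: bmf_le_integral => //; first by apply: bmf_norm; exact: bmfB.
    by apply: bmfD; [exact: bmf_cst | exact: bmfZ].
  move=> w; rewrite indicE; case: (boolP (_ \in _)) => [_|/negP wA].
    rewrite mulr1 (@le_trans _ _ (C + C))// ?lerDr ?(ltW e2)//.
    by rewrite (le_trans (ler_normB _ _))// lerD.
  rewrite mulr0 addr0 leNgt; apply/negP => h'; apply: wA; exact/mem_set.
have b1 := @bmf_indic _ _ R _ mA.
rewrite bmf_integralD//; [|exact: bmf_cst|exact: bmfZ].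
rewrite integral_cst_prob bmf_integralZ// integral_indic_fine//.
rewrite [leRHS]splitr lerD2l.
apply: (@le_trans _ _ ((C + C + 1) * (e / 2 / (C + C + 1)))); last first.
  by rewrite mulrCA divff ?mulr1// gt_eqF.
apply: ler_pM => //; rewrite ?addr_ge0 ?fine_ge0//.
by rewrite lerDl.
Unshelve. all: by end_near. Qed.

Lemma cvg_L1_mul Y V Z : (forall n, bmf (Y n)) -> bmf V -> bmf Z -> cvg_L1 Y V ->
  (fun n => \int[P]_w (Z w * Y n w)) @ \oo --> \int[P]_w (Z w * V w).
Proof.
move=> bY bV bZ YV; have [M M0 ZM] := bmf_bound bZ.
apply/cvgrPdist_le => e e0; near=> n.
have b1 := bmfM bZ bV; have b2 := bmfM bZ (bY n).
rewrite distrC -bmf_integralB//.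
apply: le_trans (bmf_le_norm_integral _ _) _ => //; first exact: bmfB.
apply: (@le_trans _ _ (\int[P]_w (M * `|Y n w - V w|))).
  apply: bmf_le_integral => //; first by apply: bmf_norm; exact: bmfB.
    by apply: bmfZ; apply: bmf_norm; exact: bmfB.
  by move=> w; rewrite -mulrBr normrM ler_wpM2r.
rewrite bmf_integralZ//; last by apply: bmf_norm; exact: bmfB.
rewrite mulrC -ler_pdivlMr//; near: n; apply: cvg_L1_near => //; exact: divr_gt0.
Unshelve. all: by end_near. Qed.

(** Between [- C] and [C] squaring is Lipschitz with constant [C + C]; the constant [C + C + 1] is
    used so that it can be divided by. *)
Lemma cvg_L1_sqr Y V C : (forall n, bmf (Y n)) -> bmf V ->
  (forall n w, `|Y n w| <= C) -> (forall w, `|V w| <= C) -> cvg_L1 Y V ->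
  (fun n => \int[P]_w (Y n w ^+ 2)) @ \oo --> \int[P]_w (V w ^+ 2).
Proof.
move=> bY bV YC VC YV.
have C0 : 0 <= C by apply: le_trans (VC point).
have C1 : 0 < C + C + 1 by rewrite ltr_wpDl// addr_ge0.
apply/cvgrPdist_le => e e0; near=> n.
have b1 := bmfX 2 bV; have b2 := bmfX 2 (bY n).
rewrite distrC -bmf_integralB//.
apply: le_trans (bmf_le_norm_integral _ _) _ => //; first exact: bmfB.
apply: (@le_trans _ _ (\int[P]_w ((C + C + 1) * `|Y n w - V w|))).
  apply: bmf_le_integral => //; first by apply: bmf_norm; exact: bmfB.
    by apply: bmfZ; apply: bmf_norm; exact: bmfB.
  move=> w; rewrite subr_sqr normrM mulrC ler_wpM2r//.
  apply: le_trans (ler_normD _ _) _; apply: (@le_trans _ _ (C + C)); first exact: lerD.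
  by rewrite lerDl.
rewrite bmf_integralZ//; last by apply: bmf_norm; exact: bmfB.
rewrite mulrC -ler_pdivlMr//; near: n; apply: cvg_L1_near => //; exact: divr_gt0.
Unshelve. all: by end_near. Qed.

Lemma cvg_L2_L1 Y V : (forall n, bmf (Y n)) -> bmf V ->
  (fun n => \int[P]_w ((Y n w - V w) ^+ 2)) @ \oo --> 0 -> cvg_L1 Y V.
Proof.
move=> bY bV /cvgrPdist_le YV; apply: cvg_L1_ub => // e e0.
have e2 : 0 < e / 2 by rewrite divr_gt0.
near=> n; have b1 := bmfB (bY n) bV; have b2 := bmfX 2 b1.
(* The pointwise inequality [x <= a + a^-1 * x ^+ 2], with [a = e / 2], does the work of
   Cauchy-Schwarz. *)
apply: (@le_trans _ _ (\int[P]_w (e / 2 + (e / 2)^-1 * (Y n w - V w) ^+ 2))).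
  apply: bmf_le_integral => //; first exact: bmf_norm.
    by apply: bmfD; [exact: bmf_cst|exact: bmfZ].
  move=> w; rewrite -(@ler_pM2l _ (e / 2))// mulrDr mulVKf ?gt_eqF//.
  rewrite -[(Y n w - V w) ^+ 2]real_normK ?num_real//.
  set x := `|_|; have x0 : 0 <= x by exact: normr_ge0.
  have : 0 <= (x - e / 2) ^+ 2 + x * (e / 2).
    by apply: addr_ge0; [exact: sqr_ge0|apply: mulr_ge0 => //; exact: ltW].
  by nra.
rewrite bmf_integralD//; [|exact: bmf_cst|exact: bmfZ].
rewrite integral_cst_prob bmf_integralZ// [leRHS]splitr lerD2l.
rewrite mulrC ler_pdivrMr//; apply: le_trans (ler_norm _) _.
rewrite -normrN -sub0r; near: n; apply: YV; exact: mulr_gt0.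
Unshelve. all: by end_near. Qed.

Lemma cvg_L1D Y V Y' V' : (forall n, bmf (Y n)) -> bmf V ->
  (forall n, bmf (Y' n)) -> bmf V' -> cvg_L1 Y V -> cvg_L1 Y' V' ->
  cvg_L1 (fun n w => Y n w + Y' n w) (fun w => V w + V' w).
Proof.
move=> bY bV bY' bV' YV YV'; apply: cvg_L1_ub; first by move=> n; exact: bmfD.
  exact: bmfD.
move=> e e0; near=> n.
have b1 := bmf_norm (bmfB (bY n) bV); have b2 := bmf_norm (bmfB (bY' n) bV').
apply: (@le_trans _ _ (\int[P]_w (`|Y n w - V w| + `|Y' n w - V' w|))).
  apply: bmf_le_integral => //; [|exact: bmfD|].
    by apply: bmf_norm; apply: bmfB; exact: bmfD.
  move=> w; rewrite opprD addrACA; exact: ler_normD.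
rewrite bmf_integralD// [leRHS]splitr lerD//; near: n; apply: cvg_L1_near => //;
  exact: divr_gt0.
Unshelve. all: by end_near. Qed.

Lemma cvg_L1Z a Y V : (forall n, bmf (Y n)) -> bmf V -> cvg_L1 Y V ->
  cvg_L1 (fun n w => a * Y n w) (fun w => a * V w).
Proof.
move=> bY bV YV; rewrite /cvg_L1.
have -> : (fun n => \int[P]_w `|a * Y n w - a * V w|) =
    (fun n => `|a| * \int[P]_w `|Y n w - V w|).
  apply/funext => n; have b1 := bmf_norm (bmfB (bY n) bV).
  rewrite -(bmf_integralZ Pfin _ b1); apply: eq_Rintegral => w _.
  by rewrite -mulrBr normrM.
suff : (fun n => `|a| * \int[P]_w `|Y n w - V w|) @ \oo --> `|a| * 0 by rewrite mulr0.
exact: cvgMr.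
Qed.

(** The L1 distance of the mean to [V] is at most the mean of the L1 distances, to which the Cesaro
    theorem for real sequences applies. *)
Lemma cvg_L1_mean Y V : (forall n, bmf (Y n)) -> bmf V -> cvg_L1 Y V ->
  cvg_L1 (fun n w => n%:R^-1 * \sum_(i < n) Y i w) V.
Proof.
move=> bY bV YV.
have bS n : bmf (fun w => n%:R^-1 * \sum_(i < n) Y i w).
  by apply: bmfZ; exact: bmf_sum.
have b1 n : bmf (fun w => `|Y n w - V w|) by apply: bmf_norm; exact: bmfB.
apply: cvg_L1_ub => // e e0.
have /cvgrPdist_le /(_ _ e0) [N _ NP] := cesaro YV.
(* [arithmetic_mean] at [n] averages [n.+1] terms, hence the shift of the threshold. *)
exists N.+1 => // -[//|n] /= Nn.
have := NP n Nn; rewrite sub0r normrN ger0_norm; last first.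
  apply: mulr_ge0; first by rewrite invr_ge0.
  by apply: sumr_ge0 => i _; apply: Rintegral_ge0.
apply: le_trans.
rewrite /arithmetic_mean/= /series/= big_mkord.
have <- : \int[P]_w (n.+1%:R^-1 * \sum_(i < n.+1) `|Y i w - V w|) =
    n.+1%:R^-1 * \sum_(i < n.+1) \int[P]_w `|Y i w - V w|.
  by rewrite bmf_integralZ ?bmf_integral_sum//; exact: bmf_sum.
apply: bmf_le_integral => //.
- by apply: bmf_norm; exact: bmfB.
- by apply: bmfZ; exact: bmf_sum.
move=> w.
have -> : n.+1%:R^-1 * (\sum_(i < n.+1) Y i w) - V w =
    n.+1%:R^-1 * \sum_(i < n.+1) (Y i w - V w).
  rewrite sumrB mulrBr; congr (_ - _).
  by rewrite sumr_const card_ord -[V w *+ _]mulr_natl mulrA mulVf ?pnatr_eq0// mul1r.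
rewrite normrM ger0_norm ?invr_ge0// ler_wpM2l ?invr_ge0//.
exact: ler_norm_sum.
Qed.

End RandomVariables.

(** * Completeness of L1 for uniformly bounded sequences *)

Lemma le_limn_sup_cst {R : realType} (u : nat -> R) (M a : R) (N : nat) :
  (forall n, `|u n| <= M) -> (forall n, (N <= n)%N -> u n <= a) -> limn_sup u <= a.
Proof.
move=> uM ua.
(* Boundedness makes the suprema of the tails exist and converge, so that [limn_sup] is a genuine
   limit. *)
have bu : bounded_fun (u : (R^o)^nat).
  by exists M; split; [exact: num_real|move=> x Mx n _; exact: le_trans (uM n) (ltW Mx)].
apply: limr_le.
  apply: cvgP; apply: cvg_sups_inf; [exact: bounded_fun_has_ubound|exact: bounded_fun_has_lbound].
exists N => // n/= Nn; apply: ge_sup; first by exists (u n); exists n => /=.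
by move=> _ [m/= nm <-]; apply: ua; exact: leq_trans Nn nm.
Qed.

Lemma ge_limn_sup_cst {R : realType} (u : nat -> R) (M a : R) (N : nat) :
  (forall n, `|u n| <= M) -> (forall n, (N <= n)%N -> a <= u n) -> a <= limn_sup u.
Proof.
move=> uM ua.
have bu : bounded_fun (u : (R^o)^nat).
  by exists M; split; [exact: num_real|move=> x Mx n _; exact: le_trans (uM n) (ltW Mx)].
apply: limr_ge.
  apply: cvgP; apply: cvg_sups_inf; [exact: bounded_fun_has_ubound|exact: bounded_fun_has_lbound].
exists N => // n/= Nn; apply: le_trans (ua n Nn) _; apply: ub_le_sup; last by exists n => /=.
by exists M => _ [m/= nm <-]; exact: le_trans (ler_norm _) (uM m).
Qed.

Section L1Complete.
Context {d : measure_display} {Omega : measurableType d} {R : realType}.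
Variable P : probability Omega R.
Let Pfin := probability_setT_lty P.

(* The limit is the [limsup] of a fast Cauchy subsequence [Z]; its distance to [Z K] is
   at most the tail of the series of increments, whose integral is geometric. *)
Lemma L1_complete (Y : nat -> Omega -> R) (C : R) :
  (forall n, bmf (Y n)) -> (forall n w, `|Y n w| <= C) ->
  (forall e, 0 < e -> exists N, forall m n, (N <= m)%N -> (N <= n)%N ->
     \int[P]_w `|Y m w - Y n w| <= e) ->
  exists2 V, bmf V & cvg_L1 P Y V.
Proof.
move=> bY YC cauchyY.
have g0 k : 0 < (2^-1 : R) ^+ k by rewrite exprn_gt0// invr_gt0.
have [N NP] := choice (fun k => cauchyY _ (g0 k)).
(* Partial sums give indices that dominate the thresholds [N k] and are nondecreasing as well. *)
pose s k := (\sum_(j < k.+1) N j)%N.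
have sN k : (N k <= s k)%N by rewrite /s big_ord_recr/= leq_addl.
have sS k : (s k <= s k.+1)%N by rewrite /s [leqRHS]big_ord_recr/= leq_addr.
pose Z k := Y (s k).
have bZ k : bmf (Z k) by exact: bY.
pose V w := limn_sup (fun k => Z k w).
have VC w : `|V w| <= C.
  rewrite ler_norml; apply/andP; split.
    apply: (@ge_limn_sup_cst _ _ C _ 0%N) => n; first exact: YC.
    by move=> _; have := YC (s n) w; rewrite ler_norml => /andP[].
  apply: (@le_limn_sup_cst _ _ C _ 0%N) => n; first exact: YC.
  by move=> _; have := YC (s n) w; rewrite ler_norml => /andP[].
have bV : bmf V.
  split; last by exists C.
  apply: measurable_fun_limn_sup => [w _|w _|n]; last exact: (bmf_measurable (bZ n)).
    by exists C => _ [n _ <-]; exact: le_trans (ler_norm _) (YC _ _).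
  exists (- C) => _ [n _ <-]; have := YC (s n) w.
  by rewrite /Z ler_norml => /andP[].
exists V => //.
have key K : \int[P]_w `|Z K w - V w| <= 2^-1 ^+ K * 2.
  pose F k w := `|Z (K + k)%N w - Z (K + k).+1 w|.
  have bF k : bmf (F k) by apply: bmf_norm; exact: bmfB.
  have bD : bmf (fun w => `|Z K w - V w|) by apply: bmf_norm; exact: bmfB.
  have F0 k w : (0 <= (F k w)%:E)%E by rewrite lee_fin /F.
  have mF k : measurable_fun [set: Omega] (fun w => (F k w)%:E).
    by apply/measurable_EFinP; exact: bmf_measurable.
  have partial m w : `|Z K w - Z (K + m)%N w| <= \sum_(0 <= k < m) F k w.
    elim: m => [|m IH]; first by rewrite addn0 subrr normr0 big_geq.
    rewrite big_nat_recr//= addnS.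
    apply: le_trans (lerD IH (lexx _)); rewrite /F.
    by rewrite -[X in `|X| <= _](subrKA (Z (K + m)%N w)) ler_normD.
  have FS w : (`|Z K w - V w|%:E <= \sum_(0 <= k <oo) (F k w)%:E)%E.
    set G := (X in (_ <= X)%E).
    have sumG m : ((\sum_(0 <= k < m) F k w)%:E <= G)%E.
      by rewrite -sumEFin; exact: nneseries_lim_ge.
    have : (0 <= G)%E by exact: nneseries_ge0.
    (* Where the series of increments is infinite the bound is trivial. Where its sum is [g], every
       [Z n] with [K <= n] lies within [g] of [Z K], and so does the upper limit. *)
    move: sumG; case: G => [g| |]; [|by move=> _ _; rewrite leey|by []].
    move=> gP g0'; rewrite lee_fin ler_distl.
    have gn n : (K <= n)%N -> `|Z K w - Z n w| <= g.
      move=> Kn; rewrite -(subnKC Kn); apply: le_trans (partial _ _) _.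
      by rewrite -lee_fin.
    rewrite -lerBlDr; apply/andP; split; rewrite ?lerBlDr.
      apply: (@le_limn_sup_cst _ _ C _ K) => n; first exact: YC.
      by move=> /gn; rewrite ler_distl => /andP[]; lra.
    rewrite -lerBlDr.
    apply: (@ge_limn_sup_cst _ _ C _ K) => n; first exact: YC.
    by move=> /gn; rewrite ler_distl => /andP[]; lra.
  have intF k : (\int[P]_w (F k w)%:E <= (2^-1 ^+ (K + k))%:E)%E.
    rewrite bmf_integralE// lee_fin; apply: NP.
      by apply: leq_trans (sN _) _.
    by apply: leq_trans (sN _) (sS _).
  rewrite -lee_fin -bmf_integralE//.
  apply: (@le_trans _ _ (\int[P]_w (\sum_(0 <= k <oo) (F k w)%:E))%E).
    apply: ge0_le_integral => //.
    - by apply/measurable_EFinP; exact: bmf_measurable.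
    - by apply: ge0_emeasurable_sum.
  rewrite integral_nneseries//.
  apply: lime_le.
    by apply: is_cvg_nneseries => n _ _; apply: integral_ge0.
  near=> m.
  apply: (@le_trans _ _ (\sum_(0 <= k < m) (2^-1 ^+ (K + k))%:E)%E).
    exact: lee_sum.
  rewrite sumEFin lee_fin.
  have -> : \sum_(0 <= k < m) (2^-1 : R) ^+ (K + k) = 2^-1 ^+ K * 2 * (1 - 2^-1 ^+ m).
    elim: (m) => [|p IH]; first by rewrite big_geq// expr0 subrr mulr0.
    rewrite big_nat_recr//= IH exprD exprS.
    set a := 2^-1 ^+ K; set b := 2^-1 ^+ p; lra.
  by rewrite ler_piMr// ?mulr_ge0 ?(ltW (g0 _))// lerBlDr lerDl ltW.
apply: cvg_L1_ub => // e e0.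
have e4 : 0 < e / 4 by rewrite divr_gt0.
have [K KP] : exists K, 2^-1 ^+ K <= e / 4.
  have /cvgrPdist_le /(_ _ e4) [K _ KP] : (fun n => (2^-1 : R) ^+ n) @ \oo --> 0.
    by apply: cvg_expr; rewrite ger0_norm ?invr_ge0// invf_lt1// ltr1n.
  by exists K; have := KP K (leqnn K); rewrite sub0r normrN ger0_norm// ltW.
exists (N K) => // n/= Kn.
have b1 := bmf_norm (bmfB (bY n) (bZ K)); have b2 := bmf_norm (bmfB (bZ K) bV).
apply: (@le_trans _ _ (\int[P]_w (`|Y n w - Z K w| + `|Z K w - V w|))).
  apply: bmf_le_integral => //; [by apply: bmf_norm; exact: bmfB|exact: bmfD|].
  by move=> w; rewrite -[X in `|X| <= _](subrKA (Z K w)) ler_normD.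
rewrite bmf_integralD//; have := key K; have := NP K n (s K) Kn (sN K).
rewrite -/(Z K); lra.
Unshelve. all: by end_near. Qed.

(** An L1 limit passes from approximating sequences to [Y] through the Cauchy criterion, with four
    errors of [e / 4]. The limits [V'] may depend on the precision, and closeness is only asked for
    large [n]; this is the form in which indicators and uniform limits are handled. *)
Lemma L1_complete_approx (Y : nat -> Omega -> R) (C : R) :
  (forall n, bmf (Y n)) -> (forall n w, `|Y n w| <= C) ->
  (forall e, 0 < e -> exists Y' V', [/\ forall n, bmf (Y' n), bmf V', cvg_L1 P Y' V' &
     \forall n \near \oo, \int[P]_w `|Y n w - Y' n w| <= e]) ->
  exists2 V, bmf V & cvg_L1 P Y V.
Proof.
move=> bY YC approxY; apply: (L1_complete bY YC) => e e0.
have e4 : 0 < e / 4 by rewrite divr_gt0.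
have [Y' [V' [bY' bV' YV' YY']]] := approxY _ e4.
have [N _ NP] := filterI YY' (cvg_L1_near YV' e4).
exists N => m n /NP[m1 m2] /NP[n1 n2].
have b1 k := bmf_norm (bmfB (bY k) (bY' k)); have b2 k := bmf_norm (bmfB (bY' k) bV').
apply: (@le_trans _ _ (\int[P]_w ((`|Y m w - Y' m w| + `|Y' m w - V' w|)
    + (`|Y n w - Y' n w| + `|Y' n w - V' w|)))).
  apply: bmf_le_integral => //; [by apply: bmf_norm; exact: bmfB|by do 2 apply: bmfD|].
  move=> w; apply: (@le_trans _ _ (`|Y m w - V' w| + `|Y n w - V' w|)).
    by rewrite [`|Y n w - V' w|]distrC -[X in `|X| <= _](subrKA (V' w)) ler_normD.
  by apply: lerD; [rewrite -[X in `|X| <= _](subrKA (Y' m w))|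
    rewrite -[X in `|X| <= _](subrKA (Y' n w))]; rewrite ler_normD.
have b3 k := bmfD (b1 k) (b2 k).
rewrite !bmf_integralD//; lra.
Qed.

End L1Complete.

(** * Predictive distributions *)

Lemma eq_by_dist {R : realFieldType} (x y k : R) :
  (forall e, 0 < e -> `|x - y| <= k * e) -> x = y.
Proof.
move=> xy; apply/eqP; rewrite -subr_eq0 -normr_le0 leNgt; apply/negP => h.
have k1 : 0 < `|k| + 1 by rewrite ltr_pwDr.
(* With this choice the distance of [x] and [y] is [2 * e] times the norm of [k] plus 1, which
   exceeds [k * e]. *)
pose e := `|x - y| / (`|k| + 1) / 2.
have e0 : 0 < e by rewrite !divr_gt0.
have xyE : `|x - y| = `|k| * e * 2 + e * 2.
  by rewrite /e; field; rewrite gt_eqF.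
have h1 : k * e <= `|k| * e by apply: ler_wpM2r (ler_norm k); exact: ltW.
have h2 : 0 <= `|k| * e by apply: mulr_ge0 => //; exact: ltW.
have := xy e e0; lra.
Qed.

Lemma mean_bound {R : realFieldType} (u : nat -> R) (C : R) (n : nat) :
  (forall i, `|u i| <= C) -> `|n%:R^-1 * \sum_(i < n) u i| <= C.
Proof.
move=> uC; have C0 : 0 <= C by exact: le_trans (normr_ge0 _) (uC 0%N).
case: n => [|n]; first by rewrite big_ord0 mulr0 normr0.
rewrite normrM ger0_norm ?invr_ge0// ler_pdivrMl ?ltr0n//.
apply: le_trans (ler_norm_sum _ _ _) _.
apply: (@le_trans _ _ (\sum_(i < n.+1) C)); first by apply: ler_sum => i _; exact: uC.
by rewrite sumr_const card_ord mulr_natl.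
Qed.

Section Predictive.
Context {R : realType} {S : ptopologicalType} {d : measure_display}
  {Omega : measurableType d}.
Variables (P : probability Omega R) (X : nat -> {mfun Omega >-> borelType S})
  (alpha : nat -> R.-pker Omega ~> borelType S).
Hypothesis halpha : predictive P X alpha.
Let Pfin := probability_setT_lty P.
Notation G n := (g_sigma_algebraType (past X n)).

Lemma measurable_past n (A : set Omega) : past X n A -> measurable A.
Proof.
apply: smallest_sub; first exact: sigma_algebra_measurable.
by move=> B [i _ [C mC <-]]; apply: measurable_funPT.
Qed.

(** [past X n] is already a sigma-algebra, so using it as the generators of [G n] adds no set. *)
Lemma measurable_gpast n (A : set (G n)) : measurable A <-> past X n A.
Proof.
split; last exact: sub_sigma_algebra.
by apply: smallest_sub => //; exact: smallest_sigma_algebra.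
Qed.

Lemma past_setT n : past X n [set: Omega].
Proof. by apply/(@measurable_gpast n); exact: measurableT. Qed.

Lemma past_le m n : (m <= n)%N -> past X m `<=` past X n.
Proof.
move=> mn; apply: sub_sigma_algebra2 => A [i im Ai]; exists i => //.
exact: leq_trans im mn.
Qed.

Lemma bmf_past n (Z : Omega -> R) : bmf (Z : G n -> R) -> bmf Z.
Proof.
move=> [mZ ZM]; split => // _ B mB.
by apply: (@measurable_past n); apply/measurable_gpast; exact: mZ.
Qed.

Lemma bmf_past_le m n (Z : Omega -> R) : (m <= n)%N ->
  bmf (Z : G m -> R) -> bmf (Z : G n -> R).
Proof.
move=> mn [mZ ZM]; split => // _ B mB.
by apply/measurable_gpast; apply: (past_le mn); apply/measurable_gpast; exact: mZ.
Qed.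

Lemma bmf_past_obs m n (f : borelType S -> R) : (m < n)%N -> bmf f ->
  bmf ((fun w => f (X m w)) : G n -> R).
Proof.
move=> mn [mf [M fM]]; split; last by exists M => x.
move=> _ B mB; apply/measurable_gpast; apply: sub_sigma_algebra.
exists m => //; exists (f @^-1` B); last by [].
by rewrite -[X in measurable X]setTI; exact: mf.
Qed.

Lemma bmf_obs n (f : borelType S -> R) : bmf f -> bmf (fun w => f (X n w)).
Proof. by move=> bf; apply: bmf_comp. Qed.

Let afin n w : (alpha n w [set: borelType S] < +oo)%E.
Proof. by rewrite prob_kernel ltry. Qed.

Lemma random_integral_cst n (a : R) w :
  random_integral (alpha n : Omega -> {measure set _ -> \bar R}) (fun=> a) w = a.
Proof. by rewrite /random_integral Rintegral_cst// prob_kernel mulr1. Qed.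

Notation "'al' n f" := (random_integral (alpha n : Omega -> {measure set _ -> \bar R}) f)
  (at level 10, n at level 8, f at level 8).

Lemma random_integral_bound n (f : S -> R) C w : bmf (f : borelType S -> R) ->
  (forall x, `|f x| <= C) -> `|al n f w| <= C.
Proof.
move=> bf fC; apply: le_trans (bmf_le_norm_integral (afin n w) bf) _.
rewrite -[leRHS](random_integral_cst n _ w); apply: bmf_le_integral => //.
- exact: bmf_norm.
- exact: bmf_cst.
Qed.

Lemma random_integral_lin n (f g : S -> R) a w :
  bmf (f : borelType S -> R) -> bmf (g : borelType S -> R) ->
  al n (fun x => a * f x + g x) w = a * al n f w + al n g w.
Proof.
move=> bf bg; rewrite /random_integral bmf_integralD//; last exact: bmfZ.
by rewrite bmf_integralZ.
Qed.

Lemma random_integral_dist n (f g : S -> R) w :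
  bmf (f : borelType S -> R) -> bmf (g : borelType S -> R) ->
  `|al n f w - al n g w| <= al n (fun x => `|f x - g x|) w.
Proof.
move=> bf bg; rewrite /random_integral -bmf_integralB//.
by apply: bmf_le_norm_integral => //; exact: bmfB.
Qed.

Lemma indicM (T : Type) (A B : set T) (x : T) :
  \1_A x * \1_B x = \1_(A `&` B) x :> R.
Proof. by rewrite !indicE in_setI -natrM mulnb. Qed.

(** This is the defining property of conditional expectation given the past. It passes from
    indicators, where it is [predictive], to bounded functions by [bmf_ind]. *)
Lemma predictive_integral n (f : S -> R) : bmf (f : borelType S -> R) ->
  bmf (al n f : G n -> R) /\
  forall H, past X n H ->
    \int[P]_w (\1_H w * al n f w) = \int[P]_w (\1_H w * f (X n w)).
Proof.
move=> bf; have [C C0 fC] := bmf_bound bf.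
pose Q (f : borelType S -> R) := measurable_fun [set: G n] (al n f) /\
  forall H, past X n H ->
    \int[P]_w (\1_H w * al n f w) = \int[P]_w (\1_H w * f (X n w)).
suff [mf fH] : Q f.
  by split => //; split => //; exists C => w; exact: random_integral_bound.
clear C C0 fC; move: f bf; apply: (@bmf_ind _ (borelType S) R Q).
- move=> A mA; have [mal int_al] := halpha n mA.
  have alE w : al n \1_A w = fine (alpha n w A).
    by rewrite /random_integral integral_indic_fine.
  split.
    rewrite (_ : al n \1_A = fun w : Omega => fine (alpha n w A)); last first.
      by apply/funext.
    exact: measurableT_comp.
  move=> H pH; have mH := measurable_past pH.
  transitivity (fine (P (H `&` X n @^-1` A))); last first.
    have mXA : measurable (X n @^-1` A).
      by rewrite -[X in measurable X]setTI; exact: measurable_funP.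
    rewrite -(integral_indic_fine P (measurableI _ _ mH mXA)).
    by apply: eq_Rintegral => w _; rewrite -indicM.
  rewrite -int_al// integral_mkcond /Rintegral; congr fine; apply: eq_integral => w _.
  rewrite alE patchE indicE; case: ifPn => _; rewrite ?mul0r// mul1r fineK//.
  rewrite ge0_fin_numE//; apply: le_lt_trans (afin n w).
  by apply: le_measure; rewrite ?inE.
- move=> a f g bf bg [mf If] [mg Ig].
  have alE w := random_integral_lin n a w bf bg.
  split.
    rewrite (_ : al n _ = fun w : Omega => a * al n f w + al n g w); last first.
      by apply/funext.
    by apply: measurable_funD => //; apply: measurable_funM.
  move=> H pH; have mH := measurable_past pH.
  have [C C0 fC] := bmf_bound bf; have [D D0 gD] := bmf_bound bg.
  have b1 : bmf (al n f).
    by apply: (@bmf_past n); split => //; exists C => w; exact: random_integral_bound.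
  have b2 : bmf (al n g).
    by apply: (@bmf_past n); split => //; exists D => w; exact: random_integral_bound.
  have bH := @bmf_indic _ _ R _ mH.
  under eq_Rintegral do rewrite alE mulrDr mulrCA.
  under [RHS]eq_Rintegral do rewrite mulrDr mulrCA.
  have b3 := bmfM bH (bmf_obs n bf); have b4 := bmfM bH (bmf_obs n bg).
  have b5 := bmfM bH b1; have b6 := bmfM bH b2.
  rewrite (bmf_integralD Pfin (bmfZ a b5) b6) (bmf_integralD Pfin (bmfZ a b3) b4).
  by rewrite (bmf_integralZ Pfin a b5) (bmf_integralZ Pfin a b3) If// Ig.
- move=> f bf approx.
  have e0 k : 0 < (k.+1%:R^-1 : R) by rewrite invr_gt0.
  have dist g e w : bmf (g : borelType S -> R) -> (forall x, `|f x - g x| <= e) ->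
      `|al n f w - al n g w| <= e.
    move=> bg fg; apply: le_trans (random_integral_dist _ _ bf bg) _.
    apply: le_trans (ler_norm _) _; apply: random_integral_bound.
      by apply: bmf_norm; exact: bmfB.
    by move=> x; rewrite normr_id.
  (* Approximations with errors [k.+1%:R^-1] converge pointwise, and a pointwise limit stays
     measurable with respect to the past. *)
  have mf : measurable_fun [set: G n] (al n f).
    have [g gP] := choice (fun k => approx _ (e0 k)).
    apply: (@measurable_fun_cvg _ (G n) R [set: G n] (fun k => al n (g k) : G n -> R)).
      by move=> k; case: (gP k) => _ [].
    move=> w _; apply/cvgrPdist_le => e e1; near=> k.
    have [bg _ fg] := gP k; apply: le_trans (dist _ _ w bg fg) _.
    by apply: ltW; near: k; exact: (near_infty_natSinv_lt (PosNum e1)).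
  split => // H pH; have mH := measurable_past pH.
  (* Replacing [f] by [g] costs at most [e] on each side of the identity, hence the constant 2. *)
  apply: (@eq_by_dist _ _ _ 2) => e ee; have [g [bg [mg Ig] fg]] := approx _ ee.
  have [C C0 fC] := bmf_bound bf; have [D D0 gD] := bmf_bound bg.
  have b1 : bmf (al n f).
    by apply: (@bmf_past n); split => //; exists C => w; exact: random_integral_bound.
  have b2 : bmf (al n g).
    by apply: (@bmf_past n); split => //; exists D => w; exact: random_integral_bound.
  have bH := @bmf_indic _ _ R _ mH.
  have b3 := bmf_obs n bf; have b4 := bmf_obs n bg.
  have b5 := bmfM bH b1; have b6 := bmfM bH b2.
  have b7 := bmfM bH b3; have b8 := bmfM bH b4.
  have small (u v : Omega -> R) : bmf u -> bmf v -> (forall w, `|u w - v w| <= e) ->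
      `|\int[P]_w (\1_H w * u w) - \int[P]_w (\1_H w * v w)| <= e.
    move=> bu bv uv; have b9 := bmfM bH bu; have b10 := bmfM bH bv.
    rewrite -bmf_integralB//.
    apply: le_trans (bmf_le_norm_integral Pfin (bmfB b9 b10)) _.
    rewrite -[leRHS](integral_cst_prob P); apply: bmf_le_integral => //.
    + by apply: bmf_norm; exact: bmfB.
    + exact: bmf_cst.
    + move=> w; rewrite -mulrBr normrM indicE.
      by case: (_ \in _); rewrite ?normr1 ?normr0 ?mul1r ?mul0r// ltW.
  have s1 := small _ _ b1 b2 (fun w => dist _ _ w bg fg).
  have s2 := small _ _ b3 b4 (fun w => fg (X n w)).
  rewrite -(Ig H pH) in s2.
  rewrite -(subrKA (\int[P]_w (\1_H w * al n g w))).
  apply: le_trans (ler_normD _ _) _; rewrite mulr_natl mulr2n lerD//.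
  by rewrite distrC.
Unshelve. all: by end_near. Qed.

Lemma bmf_predictive n (f : S -> R) : bmf (f : borelType S -> R) -> bmf (al n f).
Proof. by move=> bf; apply: (@bmf_past n); case: (predictive_integral n bf). Qed.

Lemma integral_predictive n (f : S -> R) : bmf (f : borelType S -> R) ->
  \int[P]_w (al n f w) = \int[P]_w f (X n w).
Proof.
move=> bf; have [_ /(_ _ (@past_setT n)) h] := predictive_integral n bf.
transitivity (\int[P]_w (\1_[set: Omega] w * al n f w)).
  by apply: eq_Rintegral => w _; rewrite indicT mul1r.
by rewrite h; apply: eq_Rintegral => w _; rewrite indicT mul1r.
Qed.

(** Conditional expectation contracts the L1 norm: approximating the observation also approximates
    its prediction. *)
Lemma integral_predictive_dist n (f g : S -> R) :
  bmf (f : borelType S -> R) -> bmf (g : borelType S -> R) ->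
  \int[P]_w `|al n f w - al n g w| <= \int[P]_w `|f (X n w) - g (X n w)|.
Proof.
move=> bf bg; have b1 := bmf_norm (bmfB bf bg).
rewrite -(integral_predictive n b1); apply: bmf_le_integral => //.
- by apply: bmf_norm; apply: bmfB; exact: bmf_predictive.
- exact: bmf_predictive.
- by move=> w; exact: random_integral_dist.
Qed.

Lemma integral_mul_dist (W Z Z' : Omega -> R) e M : bmf W -> bmf Z -> bmf Z' ->
  (forall w, `|W w| <= M) -> (forall w, `|Z w - Z' w| <= e) ->
  `|\int[P]_w (Z w * W w) - \int[P]_w (Z' w * W w)| <= M * e.
Proof.
move=> bW bZ bZ' WM ZZ'; have b1 := bmfM bZ bW; have b2 := bmfM bZ' bW.
rewrite -bmf_integralB//.
apply: le_trans (bmf_le_norm_integral Pfin (bmfB b1 b2)) _.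
rewrite -[leRHS](integral_cst_prob P); apply: bmf_le_integral => //.
- by apply: bmf_norm; exact: bmfB.
- exact: bmf_cst.
- by move=> w; rewrite -mulrBl normrM mulrC; exact: ler_pM.
Qed.

(** Here [bmf_ind] is applied on [G n], so that only indicators of past events need to be tested. *)
Lemma past_orthogonal n (W Z : Omega -> R) : bmf W -> bmf (Z : G n -> R) ->
  (forall H, past X n H -> \int[P]_w (\1_H w * W w) = 0) ->
  \int[P]_w (Z w * W w) = 0.
Proof.
move=> bW bZ W0; have [M M0 WM] := bmf_bound bW.
pose Q (Z : G n -> R) := \int[P]_w (Z w * W w) = 0.
suff : Q Z by [].
move: Z bZ; apply: (@bmf_ind _ (G n) R Q).
- by move=> H /measurable_gpast; exact: W0.
- move=> a f g /bmf_past bf /bmf_past bg Qf Qg.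
  have b1 := bmfM bf bW; have b2 := bmfM bg bW; rewrite /Q.
  transitivity (\int[P]_w (a * (f w * W w) + g w * W w)).
    by apply: eq_Rintegral => w _; ring.
  rewrite (bmf_integralD Pfin (bmfZ a b1) b2) (bmf_integralZ Pfin a b1).
  by rewrite [X in _ + X]Qg [X in _ * X]Qf mulr0 addr0.
- move=> f bf approx; apply: (@eq_by_dist _ _ _ M) => e /approx[g [bg Qg fg]].
  by have := integral_mul_dist bW (bmf_past bf) (bmf_past bg) WM fg; rewrite [X in _ - X]Qg.
Qed.

(** * Martingale differences of the observations *)

Definition innovation (f : S -> R) n (w : Omega) : R := f (X n w) - al n f w.

Section Innovation.
Variable f : S -> R.
Hypothesis bf : bmf (f : borelType S -> R).
Notation Y := (innovation f).

Lemma bmf_innovation n : bmf (Y n).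
Proof. by apply: bmfB; [exact: bmf_obs bf|exact: bmf_predictive]. Qed.

Lemma innovation_past n (Z : Omega -> R) : bmf (Z : G n -> R) ->
  \int[P]_w (Z w * Y n w) = 0.
Proof.
move=> bZ; apply: (past_orthogonal (bmf_innovation n) bZ) => H pH.
have [_ /(_ _ pH) h] := predictive_integral n bf.
have bH := @bmf_indic _ _ R _ (measurable_past pH).
have b1 := bmfM bH (bmf_obs n bf); have b2 := bmfM bH (bmf_predictive n bf).
transitivity (\int[P]_w (\1_H w * f (X n w) - \1_H w * al n f w)).
  by apply: eq_Rintegral => w _; rewrite -mulrBr.
by rewrite (bmf_integralB Pfin b1 b2) h subrr.
Qed.

(** For [m < n] both [f (X m)] and its prediction are measurable with respect to the past at [n], so
    the earlier innovation is an admissible test variable. *)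
Lemma innovation_orthogonal m n : (m < n)%N -> \int[P]_w (Y m w * Y n w) = 0.
Proof.
move=> mn; apply: innovation_past; apply: bmfB; first exact: bmf_past_obs.
by apply: (bmf_past_le (ltnW mn)); case: (predictive_integral m bf).
Qed.

Lemma innovation_bound : exists2 C, 0 < C & forall n w, `|Y n w| <= C.
Proof.
have [C C0 fC] := bmf_bound bf; exists (C + C); first exact: addr_gt0.
move=> n w; apply: le_trans (ler_normB _ _) _; apply: lerD; first exact: fC.
exact: random_integral_bound.
Qed.

Lemma innovation_cvg0 Z : bmf Z -> (fun n => \int[P]_w (Z w * Y n w)) @ \oo --> 0.
Proof.
move=> bZ; have [C C0 YC] := innovation_bound.
exact: (bessel_cvg0 C0 bmf_innovation YC innovation_orthogonal).
Qed.

(** By orthogonality the sum of [n] innovations has second moment at most [n * C ^+ 2], so that of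
    the mean is at most [C ^+ 2 / n]. *)
Lemma innovation_mean : cvg_L1 P (fun n w => n%:R^-1 * \sum_(i < n) Y i w) (fun=> 0).
Proof.
have [C C0 YC] := innovation_bound.
have bS n : bmf (fun w => \sum_(i < n) Y i w) by apply: bmf_sum => i; exact: bmf_innovation.
apply: cvg_L2_L1; [by move=> n; exact: bmfZ|exact: bmf_cst|].
apply/cvgrPdist_le => e e0.
have e1 : 0 < e / C ^+ 2 by rewrite divr_gt0// exprn_gt0.
have [N _ NP] := near_infty_natSinv_lt (PosNum e1).
exists N.+1 => // -[//|n]/= Nn; rewrite sub0r normrN ger0_norm; last first.
  by apply: Rintegral_ge0 => w _; exact: sqr_ge0.
have := orthogonal_sum_sqr C0 bmf_innovation YC innovation_orthogonal n.+1 => h.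
have b1 := bmfX 2 (bS n.+1).
have -> : \int[P]_w ((n.+1%:R^-1 * \sum_(i < n.+1) Y i w - 0) ^+ 2) =
    n.+1%:R^-1 ^+ 2 * \int[P]_w ((\sum_(i < n.+1) Y i w) ^+ 2).
  rewrite -(bmf_integralZ Pfin _ b1); apply: eq_Rintegral => w _.
  by rewrite subr0 exprMn.
have n0 : (0 : R) < n.+1%:R by rewrite ltr0n.
have h1 : n.+1%:R^-1 <= e / C ^+ 2 by apply/ltW/NP.
apply: le_trans (ler_wpM2l (sqr_ge0 _) h) _.
rewrite expr2 -mulrA mulKf ?gt_eqF// -ler_pdivlMr ?exprn_gt0//.
Qed.

Lemma integral_mul_innovation Z n : bmf Z ->
  \int[P]_w (Z w * f (X n w)) = \int[P]_w (Z w * Y n w) + \int[P]_w (Z w * al n f w).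
Proof.
move=> bZ; have b1 := bmfM bZ (bmf_innovation n); have b2 := bmfM bZ (bmf_predictive n bf).
rewrite -(bmf_integralD Pfin b1 b2); apply: eq_Rintegral => w _.
by rewrite -mulrDr subrK.
Qed.

(** Against any fixed bounded [Z] the innovation disappears in the limit, so the observation may be
    replaced by its prediction. *)
Lemma predictive_cvg_obs V Z : bmf V -> bmf Z -> cvg_L1 P (fun n => al n f) V ->
  (fun n => \int[P]_w (Z w * f (X n w))) @ \oo --> \int[P]_w (Z w * V w).
Proof.
move=> bV bZ aV; under eq_fun do rewrite integral_mul_innovation//.
rewrite -[\int[P]_w (Z w * V w)]add0r; apply: cvgD; first exact: innovation_cvg0.
by apply: cvg_L1_mul => // n; exact: bmf_predictive.
Qed.

Lemma predictive_cvg_mean V : bmf V -> cvg_L1 P (fun n => al n f) V ->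
  cvg_L1 P (fun n w => n%:R^-1 * \sum_(i < n) f (X i w)) V.
Proof.
move=> bV aV; have ba n := bmf_predictive n bf.
have := cvg_L1D _ (bmf_cst 0) _ bV innovation_mean (cvg_L1_mean ba bV aV).
have -> : (fun w => 0 + V w) = V by apply/funext => w; rewrite add0r.
rewrite (_ : (fun n w => _ + _) = (fun n w => n%:R^-1 * \sum_(i < n) f (X i w))).
  apply => n; first by apply: bmfZ; apply: bmf_sum => i; exact: bmf_innovation.
  by apply: bmfZ; exact: bmf_sum.
apply/funext => n; apply/funext => w; rewrite -mulrDr -big_split/=.
by congr (_ * _); apply: eq_bigr => i _; rewrite subrK.
Qed.

(** For an event [H] the limit exists by assumption; it is identified by its Cesaro means, which are
    the integrals of the empirical means over [H]. Linearity and uniform approximation extend this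
    to every bounded [Z]. *)
Lemma obs_cvg V : bmf V ->
  cvg_L1 P (fun n w => n%:R^-1 * \sum_(i < n) f (X i w)) V ->
  (forall H, measurable H -> cvgn (fun n => \int[P]_w (\1_H w * f (X n w)))) ->
  forall Z, bmf Z -> (fun n => \int[P]_w (Z w * f (X n w))) @ \oo --> \int[P]_w (Z w * V w).
Proof.
move=> bV meanV cvgH; have bX n := bmf_obs n bf.
pose Q (Z : Omega -> R) :=
  (fun n => \int[P]_w (Z w * f (X n w))) @ \oo --> \int[P]_w (Z w * V w).
apply: (@bmf_ind _ _ _ Q).
- move=> H mH; have bH := @bmf_indic _ _ R _ mH.
  have b1 n := bmfM bH (bX n).
  have /cvg_ex[l ul] := cvgH H mH.
  rewrite /Q; suff <- : l = \int[P]_w (\1_H w * V w) by [].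
  have bM n : bmf (fun w => n%:R^-1 * \sum_(i < n) f (X i w)) by apply: bmfZ; exact: bmf_sum.
  (* The shift matches [arithmetic_mean], which divides by [n.+1], and avoids the empty mean at
     0. *)
  have := cvg_L1_mul bM bV bH meanV; rewrite -cvg_shiftS.
  suff -> : (fun n => \int[P]_w (\1_H w * (n.+1%:R^-1 * \sum_(i < n.+1) f (X i w)))) =
      arithmetic_mean (fun n => \int[P]_w (\1_H w * f (X n w))).
    exact: (cvg_unique _ (cesaro ul)).
  apply/funext => n; rewrite /arithmetic_mean/= /series/= big_mkord.
  rewrite -bmf_integral_sum// -bmf_integralZ//; last exact: bmf_sum.
  by apply: eq_Rintegral => w _; rewrite mulrCA mulr_sumr.
- move=> a g h bg bh Qg Qh; rewrite /Q.
  have E W : bmf W -> \int[P]_w ((a * g w + h w) * W w) =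
      a * \int[P]_w (g w * W w) + \int[P]_w (h w * W w).
    move=> bW; have b1 := bmfM bg bW; have b2 := bmfM bh bW.
    rewrite -(bmf_integralZ Pfin a b1) -(bmf_integralD Pfin (bmfZ a b1) b2).
    by apply: eq_Rintegral => w _; ring.
  rewrite E//; under eq_fun do rewrite E//.
  by apply: cvgD => //; exact: cvgMr.
- move=> g bg approx; rewrite /Q; apply/cvgrPdist_le => e e0.
  have [C C0 fC] := bmf_bound bf; have [D D0 VD] := bmf_bound bV.
  (* Replacing [g] by [h] costs [C * e'] before the limit and [D * e'] in it, together [e / 3]. *)
  pose e' := e / 3 / (C + D).
  have CD0 : 0 < C + D by exact: addr_gt0.
  have e'0 : 0 < e' by rewrite /e' !divr_gt0.
  have [h [bh Qh gh]] := approx e' e'0.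
  have e3 : 0 < e / 3 by rewrite divr_gt0.
  have s1 n := integral_mul_dist (bX n) bg bh (fun w => fC (X n w)) gh.
  have s2 := integral_mul_dist bV bg bh VD gh.
  move/cvgrPdist_le : Qh => /(_ _ e3); apply: filterS => n s3.
  have eE : C * e' + D * e' = e / 3 by rewrite /e'; field; rewrite gt_eqF.
  have C1 : 0 <= C * e' by apply: mulr_ge0; exact: ltW.
  have D1 : 0 <= D * e' by apply: mulr_ge0; exact: ltW.
  move: (s1 n) s2 s3; rewrite !ler_norml => /andP[? ?] /andP[? ?] /andP[? ?].
  by apply/andP; split; lra.
Qed.

Lemma cvg_L1_predictive V C : bmf V ->
  (forall x, `|f x| <= C) -> (forall w, `|V w| <= C) ->
  cvg_L1 P (fun n w => n%:R^-1 * \sum_(i < n) f (X i w)) V ->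
  (forall H, measurable H -> cvgn (fun n => \int[P]_w (\1_H w * f (X n w)))) ->
  (fun n => \int[P]_w (al n f w ^+ 2 - (n%:R^-1 * \sum_(i < n) f (X i w)) ^+ 2))
    @ \oo --> 0 ->
  cvg_L1 P (fun n => al n f) V.
Proof.
move=> bV fC VC meanV cvgH sq0; have ba n := bmf_predictive n bf.
have bM n : bmf (fun w => n%:R^-1 * \sum_(i < n) f (X i w)).
  by apply: bmfZ; apply: bmf_sum => i; exact: bmf_obs.
have MC n w := mean_bound n (fun i => fC (X i w)).
have lim1 := obs_cvg bV meanV cvgH bV.
(* [obs_cvg] is used with the limit [V] itself as test variable; dropping the innovation turns
   observations into predictions. *)
have lim2 : (fun n => \int[P]_w (V w * al n f w)) @ \oo --> \int[P]_w (V w * V w).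
  rewrite -[\int[P]_w (V w * V w)]subr0.
  rewrite (_ : (fun n => _) = fun n => \int[P]_w (V w * f (X n w)) - \int[P]_w (V w * Y n w)).
    by apply: cvgB => //; exact: innovation_cvg0.
  by apply/funext => n; rewrite integral_mul_innovation// addrC addKr.
have lim3 := cvg_L1_sqr bM bV MC VC meanV.
have b2 := bmfX 2 bV.
apply: cvg_L2_L1 => //.
(* The squared distance to [V] is expanded after adding and subtracting the square of the empirical
   mean; the four terms tend to [0], [v], [- 2 * v] and [v], where [v] is the second moment of
   [V]. *)
rewrite (_ : (fun n => _) = fun n =>
    \int[P]_w (al n f w ^+ 2 - (n%:R^-1 * \sum_(i < n) f (X i w)) ^+ 2)
    + \int[P]_w ((n%:R^-1 * \sum_(i < n) f (X i w)) ^+ 2)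
    - 2 * \int[P]_w (V w * al n f w) + \int[P]_w (V w ^+ 2)); last first.
  apply/funext => n; have b3 := bmfX 2 (ba n); have b4 := bmfX 2 (bM n).
  have b5 := bmfM bV (ba n).
  rewrite -(bmf_integralD Pfin (bmfB b3 b4) b4) -(bmf_integralZ Pfin 2 b5).
  rewrite -(bmf_integralB Pfin (bmfD (bmfB b3 b4) b4) (bmfZ 2 b5)).
  rewrite -(bmf_integralD Pfin (bmfB (bmfD (bmfB b3 b4) b4) (bmfZ 2 b5)) b2).
  by apply: eq_Rintegral => w _; ring.
have VV : \int[P]_w (V w * V w) = \int[P]_w (V w ^+ 2).
  by apply: eq_Rintegral => w _; rewrite expr2.
rewrite VV in lim2; set v := \int[P]_w (V w ^+ 2) in lim2 lim3 *.
suff : (fun n =>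
    \int[P]_w (al n f w ^+ 2 - (n%:R^-1 * \sum_(i < n) f (X i w)) ^+ 2)
    + \int[P]_w ((n%:R^-1 * \sum_(i < n) f (X i w)) ^+ 2)
    - 2 * \int[P]_w (V w * al n f w) + v) @ \oo --> 0 + v - 2 * v + v.
  by rewrite (_ : 0 + v - 2 * v + v = 0)//; ring.
apply: cvgD; last exact: cvg_cst.
apply: cvgB; first exact: cvgD.
exact: cvgMr.
Qed.

End Innovation.

(** * Integrals against empirical measures *)

Lemma empiricalE (f : S -> R) n w : bmf (f : borelType S -> R) ->
  random_integral (empirical X n) f w = n%:R^-1 * \sum_(i < n) f (X i w).
Proof.
move=> bf.
pose mu : {measure set (borelType S) -> \bar R} := empirical X n w.
have mE (B : set (borelType S)) : mu B = (n%:R^-1 * \sum_(i < n) \1_B (X i w))%:E.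
  rewrite /mu /empirical /mscale /msum/= EFinM -sumEFin; congr (_ * _)%E.
have efin : (mu [set: borelType S] < +oo)%E by rewrite mE ltry.
pose Q (f : borelType S -> R) :=
  random_integral (empirical X n) f w = n%:R^-1 * \sum_(i < n) f (X i w).
suff : Q f by [].
move: f bf; apply: (@bmf_ind _ (borelType S) R Q).
- move=> A mA; rewrite /Q/random_integral integral_indic_fine//.
  exact: (congr1 fine (mE A)).
- move=> a f g bf bg Qf Qg; rewrite /Q/random_integral bmf_integralD//; last exact: bmfZ.
  rewrite bmf_integralZ// [X in a * X]Qf [X in _ + X]Qg.
  by rewrite mulrCA -mulrDr mulr_sumr -big_split.
- move=> f bf approx; rewrite /Q.
  (* This is the total mass of the empirical measure: 1 in general, but 0 for [n = 0], where the
     inverse is 0 by convention. *)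
  have nn : n%:R^-1 * n%:R <= 1 :> R.
    have [->|n0] := eqVneq n 0%N; first by rewrite mulr0.
    by rewrite mulVf// pnatr_eq0.
  apply: (@eq_by_dist _ _ _ 2) => e e0; have [g [bg Qg fg]] := approx e e0.
  have b1 := bmf_norm (bmfB bf bg).
  have s1 : `|random_integral (empirical X n) f w - random_integral (empirical X n) g w| <= e.
    rewrite /random_integral -bmf_integralB//.
    apply: le_trans (bmf_le_norm_integral efin (bmfB bf bg)) _.
    apply: (@le_trans _ _ (\int[mu]_x e)).
      by apply: bmf_le_integral => //; exact: bmf_cst.
    rewrite Rintegral_cst//; apply: ler_piMr; first exact: ltW.
    apply: le_trans _ nn; have /(congr1 fine)/= := mE [set: borelType S].
    by under eq_bigr do rewrite indicT; rewrite sumr_const card_ord => <-.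
  have s2 : `|n%:R^-1 * \sum_(i < n) f (X i w) - n%:R^-1 * \sum_(i < n) g (X i w)| <= e.
    rewrite -mulrBr -sumrB normrM ger0_norm ?invr_ge0//.
    apply: (@le_trans _ _ (n%:R^-1 * (n%:R * e))).
      apply: ler_wpM2l; first by rewrite invr_ge0.
      apply: le_trans (ler_norm_sum _ _ _) _.
      apply: (@le_trans _ _ (\sum_(i < n) e)); first by apply: ler_sum => i _; exact: fg.
      by rewrite sumr_const card_ord mulr_natl.
    by rewrite mulrA ler_piMl// ltW.
  rewrite -Qg in s2; move: s1 s2; rewrite !ler_norml => /andP[? ?] /andP[? ?].
  by apply/andP; split; lra.
Qed.

End Predictive.

(** * Nikodym convergence theorem *)

Section Nikodym.
Context {d : measure_display} {T : measurableType d} {R : realType}.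
Variable mu : nat -> probability T R.
Let q n (B : set T) : R := fine (mu n B).
Hypothesis cvg_q : forall B, measurable B -> cvgn (q^~ B).

Let qE n B : measurable B -> (q n B)%:E = mu n B.
Proof. by move=> mB; rewrite /q fineK// fin_num_measure. Qed.

Let q_le n A B : measurable A -> measurable B -> A `<=` B -> q n A <= q n B.
Proof. by move=> mA mB AB; rewrite -lee_fin !qE// le_measure ?inE. Qed.

Let qU n A B : measurable A -> measurable B -> q n (A `|` B) <= q n A + q n B.
Proof.
move=> mA mB; rewrite -lee_fin EFinD !qE//; last exact: measurableU.
exact: measureU2.
Qed.

Let qU_disj n A B : measurable A -> measurable B -> A `&` B = set0 ->
  q n (A `|` B) = q n A + q n B.
Proof.
move=> mA mB AB; apply: EFin_inj; rewrite EFinD !qE//; last exact: measurableU.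
exact: measureU.
Qed.

(* Sliding hump: were the conclusion false, one could pick [n_0 < n_1 < ...] and
   [k_0 <= k_1 <= ...] such that [mu (n_i)] has mass at least [9e/10] on the hump
   [A k_i \ A k_(i+1)], mass at most [e/10] on [A k_(i+1)], and is within [e/10] of its limit
   on the union [C_i] of the even humps preceding the [i]-th.  The measures [mu (n_i)] of
   the union of all even humps then oscillate with the parity of [i]. *)
Lemma nikodym_tail (A : nat -> set T) : (forall k, measurable (A k)) ->
  (forall k, A k.+1 `<=` A k) -> \bigcap_k A k = set0 ->
  forall e, 0 < e -> exists k, \forall n \near \oo, q n (A k) <= e.
Proof.
move=> mA AS A0 e e0; apply: contrapT => /forallNP noK.
have {}noK k N : exists2 n, (N <= n)%N & e < q n (A k).
  apply: contrapT => h; apply: (noK k); exists N => // n/= Nn.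
  by rewrite leNgt; apply/negP => ?; apply: h; exists n.
have A_le j k : (j <= k)%N -> A k `<=` A j.
  move=> /subnK <-; elim: (k - j)%N => [|p IH]; first by rewrite add0n.
  by rewrite addSn; exact: subset_trans (AS _) IH.
have e10 : 0 < e / 10 by rewrite divr_gt0.
have qA0 n : exists K, forall k, (K <= k)%N -> q n (A k) <= e / 10.
  have : (mu n \o A) @ \oo --> mu n (\bigcap_k A k).
    apply: nonincreasing_cvg_mu => //.
    - by apply: le_lt_trans (probability_le1 _ _) (ltry _).
    - by rewrite A0; exact: measurable0.
    - by apply/nonincreasing_seqP => k; apply/subsetPset.
  rewrite A0 measure0 => /fine_cvg /cvgrPdist_le /(_ _ e10)[K _ KP].
  exists K => k /KP; rewrite sub0r normrN; exact: le_trans (ler_norm _).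
pose L B := limn (q^~ B).
have near_L B : measurable B -> exists N, forall n, (N <= n)%N -> `|L B - q n B| <= e / 10.
  by move=> mB; have /cvgrPdist_le /(_ _ e10)[N _ NP] := cvg_q mB; exists N.
(* A state holds the current index [k], the union [C] of the humps so far and a lower bound for the
   next time; the step returns that time and the next index. The value [(0, 0)] for a nonmeasurable
   [C] only makes the choice function total. *)
have step (x : nat * set T * nat) : exists y : nat * nat, measurable x.1.2 ->
    [/\ (x.2 <= y.1)%N, (x.1.1 <= y.2)%N, e < q y.1 (A x.1.1),
        `|L x.1.2 - q y.1 x.1.2| <= e / 10 & q y.1 (A y.2) <= e / 10].
  case: x => -[k C] N/=; have [mC|?] := pselect (measurable C); last by exists (0, 0)%N.
  have [N' N'P] := near_L _ mC.
  have [n Nn en] := noK k (maxn N N').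
  have [K KP] := qA0 n.
  exists (n, maxn k K) => /= _; split => //.
  - exact: leq_trans (leq_maxl _ _) Nn.
  - exact: leq_maxl.
  - by apply: N'P; exact: leq_trans (leq_maxr _ _) Nn.
  - by apply: KP; exact: leq_maxr.
have [F FP] := choice step.
pose hump i (k k' : nat) := if odd i then set0 else A k `\` A k'.
(* Passing on the successor of the chosen time makes the times strictly increasing, whence
   [n_ge]. *)
pose s := fix s i := if i isn't j.+1 then (0%N, set0, 0%N) : nat * set T * nat else
  ((F (s j)).2, (s j).1.2 `|` hump j (s j).1.1 (F (s j)).2, (F (s j)).1.+1).
pose K i := (s i).1.1; pose C i := (s i).1.2; pose n i := (F (s i)).1.
have KS i : K i.+1 = (F (s i)).2 by [].
have CS i : C i.+1 = C i `|` hump i (K i) (K i.+1) by [].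
have mH i : measurable (hump i (K i) (K i.+1)).
  by rewrite /hump; case: ifP => _ //; exact: measurableD.
have mC i : measurable (C i).
  by elim: i => [|i IH]; [exact: measurable0|rewrite CS; exact: measurableU].
have P i := FP (s i) (mC i).
have C_le j i : (j <= i)%N -> C j `<=` C i.
  move=> /subnK <-; elim: (i - j)%N => [|p IH]; first by rewrite add0n.
  by rewrite addSn CS; apply: subset_trans IH _; exact: subsetUl.
have AK i : A (K i.+1) `<=` A (K i).
  by apply: A_le; rewrite KS; have [] := P i.
have humpA i : hump i (K i) (K i.+1) `<=` A (K i).
  by rewrite /hump; case: ifP => _ // x [].
have CA j i : C j `<=` C i `|` A (K i).
  have [ji|/subnK <-] := leqP j i; first by move=> x /(C_le _ _ ji); left.
  elim: (j - i.+1)%N => [|p IH].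
    by rewrite add0n CS => x [|/humpA]; [left|right].
  rewrite addSn CS => x [/IH//|/humpA xA]; right.
  by move: xA; rewrite addnS -addSn; elim: (p.+1) => [//|r IHr] xA; apply: IHr; exact: AK.
have disj i : C i `&` A (K i) = set0.
  apply/seteqP; split => // x; elim: i => [|i IH]; first by case.
  rewrite CS => -[[xC xA|]]; first by apply: IH; split => //; exact: AK.
  by rewrite /hump; case: ifP => _ // -[].
pose J := \bigcup_i C i.
have mJ : measurable J by exact: bigcupT_measurable.
have [N NP] := near_L _ mJ.
have n_ge i : (i <= n i)%N.
  have [h _ _ _ _] := P i; apply: leq_trans h.
  by elim: i => // i IH; apply: leq_ltn_trans IH _; rewrite /= ltnS; have [] := P i.
(* No hump is added at an odd stage, so [J] outside [C i] lies in [A (K i.+1)], which has mass at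
   most [e / 10]. *)
have up i : odd i -> q (n i) J <= L (C i) + e / 10 + e / 10.
  move=> oi; have [_ _ _ h1 h2] := P i.
  have CE : C i.+1 = C i by rewrite CS /hump oi setU0.
  have JC : J `<=` C i `|` A (K i.+1) by move=> x [j _ /(CA j i.+1)]; rewrite CE.
  have := q_le (n i) mJ (measurableU _ _ (mC i) (mA (K i.+1))) JC.
  have := qU (n i) (mC i) (mA (K i.+1)).
  move: h1 h2; rewrite -/(n i) -/(C i) -KS ler_norml => /andP[? ?] ? ? ?.
  lra.
(* At an even stage [J] contains, besides [C i], a disjoint hump of mass at least [e - e / 10]. *)
have low i : ~~ odd i -> L (C i) - e / 10 + e - e / 10 <= q (n i) J.
  move=> oi; have [_ _ h0 h1 h2] := P i.
  have JC : C i `|` hump i (K i) (K i.+1) `<=` J by rewrite -CS; exact: bigcup_sup.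
  have CH : C i `&` hump i (K i) (K i.+1) = set0.
    by apply/seteqP; split => // x [xC /humpA xA]; rewrite -(disj i).
  have := q_le (n i) (measurableU _ _ (mC i) (mH i)) mJ JC.
  rewrite qU_disj//.
  have AE : A (K i) = hump i (K i) (K i.+1) `|` A (K i.+1).
    by rewrite /hump (negbTE oi) setUC setDUK.
  have := qU (n i) (mH i) (mA (K i.+1)); rewrite -AE.
  move: h0 h1 h2; rewrite -/(n i) -/(C i) -/(K i) -KS ler_norml => ? /andP[? ?] ? ? ?.
  lra.
(* Stages [i] and [i.+1] share the same [C], so the two masses of [J] differ by at least
   [6 * e / 10], although both are within [e / 10] of the limit. *)
pose i := (N.*2).+1.
have oi : odd i by rewrite /i/= odd_double.
have CE : C i.+1 = C i by rewrite CS /hump oi setU0.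
have Ni : (N <= i)%N by rewrite /i -addnn leqW// leq_addr.
have u := up _ oi; have l : L (C i.+1) - e / 10 + e - e / 10 <= q (n i.+1) J.
  by apply: low; rewrite /= odd_double.
have := NP _ (leq_trans Ni (n_ge i)).
have := NP _ (leq_trans (leqW Ni) (n_ge i.+1)).
move: l; rewrite CE !ler_norml => l /andP[? ?] /andP[? ?].
suff : e <= 0 by rewrite leNgt e0.
lra.
Qed.

End Nikodym.

(** * Uniform approximation by continuous functions *)

(** Open sets are cozero sets: the trace of metrizability that survives homeomorphisms and passage
    to subspaces. *)
Definition cozero_opens (R : realType) (S : topologicalType) : Prop :=
  forall U : set S, open U -> exists2 g : S -> R, continuous g &
    forall x, 0 <= g x /\ (0 < g x <-> U x).

(** The function is the distance to the complement, positive on [U] because [U] contains a ball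
    around each of its points. When the complement is empty that distance is infinite, and the
    constant 1 is taken. *)
Lemma metric_cozero (R : realType) (M : metricType R) : cozero_opens R M.
Proof.
move=> U oU; have [U0|/set0P[a Ua]] := eqVneq (~` U) set0.
  exists (fun=> 1); first by move=> x; exact: cvg_cst.
  move=> x; split => //; split => // _; apply: contrapT => Ux.
  by have : (~` U) x by []; rewrite U0.
pose D x := edist_inf (~` U) x.
have Dfin x : D x \is a fin_num.
  rewrite ge0_fin_numE ?edist_inf_ge0//.
  apply: (@le_lt_trans _ _ (edist (x, a))); first by apply: ereal_inf_lbound; exists a.
  rewrite -ge0_fin_numE ?edist_ge0//; apply/edist_finP => /=.
  exists (mdist x a + 1); first by rewrite ltr_wpDl// mdist_ge0.
  by rewrite ballEmdist/= ltrDl.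
exists (fun x => fine (D x)).
  by move=> x; apply: fine_cvg; rewrite fineK//; exact: edist_inf_continuous.
move=> x; split; first by rewrite fine_ge0// edist_inf_ge0.
split => [D0|Ux].
  by apply: contrapT => nUx; move: D0; rewrite /D (edist_inf0 nUx) ltxx.
have /nbhs_ballP[r/= r0 rU] : nbhs x U by exact: open_nbhs_nbhs.
rewrite -lte_fin fineK//; apply: (@lt_le_trans _ _ r%:E); first by rewrite lte_fin.
apply: le_ereal_inf_tmp => _ [b/= nUb <-]; rewrite leNgt; apply/negP => br.
by apply: nUb; apply: rU; exact: (edist_lt_ball br).
Qed.

(** The assumptions say that [S] carries the initial topology of [h], which covers both
    homeomorphisms and subspace inclusions. *)
Lemma preimage_cozero (R : realType) (S T : topologicalType) (h : S -> T) :
  continuous h -> (forall U, open U -> exists2 V, open V & U = h @^-1` V) ->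
  cozero_opens R T -> cozero_opens R S.
Proof.
move=> ch hU cT U /hU[V oV ->]; have [g cg gV] := cT V oV.
exists (g \o h) => [x|x]; last exact: gV.
by apply: continuous_comp; [exact: ch|exact: cg].
Qed.

Lemma homeomorphic_cozero (R : realType) (S T : topologicalType) :
  homeomorphic S T -> cozero_opens R T -> cozero_opens R S.
Proof.
move=> [h [h' [hK h'K ch ch']]]; apply: (preimage_cozero ch) => U oU.
exists (h' @^-1` U); first by move/continuousP : ch'; exact.
by apply/seteqP; split => x /=; rewrite hK.
Qed.

Lemma standard_borel_cozero (R : realType) (S : topologicalType) :
  standard_borel R S -> cozero_opens R S.
Proof.
move=> [T [A [[M [_ _ TM]] _ SA]]]; apply: (homeomorphic_cozero SA).
have := homeomorphic_cozero TM (@metric_cozero R M).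
apply: (@preimage_cozero _ _ _ set_val); first exact: initial_continuous.
by move=> U [V oV <-]; exists V.
Qed.

Lemma continuous_bmf (R : realType) (S : ptopologicalType) (f : S -> R) (M : R) :
  continuous f -> (forall x, `|f x| <= M) -> bmf (f : borelType S -> R).
Proof.
move=> cf fM; split; last by exists M.
apply: (measurability _ (RGenOpens.measurableE R)).
move=> _ [_ [a [b ->] <-]]; rewrite setTI; apply: sub_sigma_algebra.
by move/continuousP : cf; apply; exact: interval_open.
Qed.

(** * Approximation in law, from open sets to Borel sets *)

Section Approximation.
Context {R : realType} {S : ptopologicalType} {d : measure_display}
  {Omega : measurableType d}.
Variables (P : probability Omega R) (X : nat -> {mfun Omega >-> borelType S}).
Hypothesis cvgX : forall B : set (borelType S), measurable B ->
  cvgn (fun n => fine (P (X n @^-1` B))).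
Let Pfin := probability_setT_lty P.

Let nikodym_tail_law (A : nat -> set (borelType S)) : (forall k, measurable (A k)) ->
  (forall k, A k.+1 `<=` A k) -> \bigcap_k A k = set0 ->
  forall e, 0 < e -> exists k, \forall n \near \oo, \int[P]_w \1_(A k) (X n w) <= e.
Proof.
move=> mA AS A0 e e0.
have [k kP] := @nikodym_tail _ _ R (fun n => distribution P (X n)) cvgX A mA AS A0 e e0.
exists k; apply: filterS kP => n; apply: le_trans.
rewrite le_eqVlt; apply/orP; left; apply/eqP.
have mX : measurable (X n @^-1` A k).
  by rewrite -[X in measurable X]setTI; exact: measurable_funP.
by rewrite -[RHS](integral_indic_fine P mX).
Qed.

(** The function is chosen before [n]: a single one serves all large times. *)
Definition law_approximable (B : set (borelType S)) := forall e, 0 < e ->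
  exists f : S -> R, [/\ continuous f, forall x, 0 <= f x <= 1 &
    \forall n \near \oo, \int[P]_w `|\1_B (X n w) - f (X n w)| <= e].

Let unit_bmf (f : S -> R) : continuous f -> (forall x, 0 <= f x <= 1) ->
  bmf (f : borelType S -> R).
Proof.
move=> cf f01; apply: (@continuous_bmf _ _ _ 1) => // x.
by have /andP[f0 f1] := f01 x; rewrite ger0_norm.
Qed.

Let near_le_sum (f g h : borelType S -> R) e1 e2 :
  bmf f -> bmf g -> bmf h -> (forall x, f x <= g x + h x) ->
  (\forall n \near \oo, \int[P]_w g (X n w) <= e1) ->
  (\forall n \near \oo, \int[P]_w h (X n w) <= e2) ->
  \forall n \near \oo, \int[P]_w f (X n w) <= e1 + e2.
Proof.
move=> bf bg bh fgh ge he; near=> n.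
have b1 := bmf_obs X n bf; have b2 := bmf_obs X n bg; have b3 := bmf_obs X n bh.
apply: (@le_trans _ _ (\int[P]_w (g (X n w) + h (X n w)))).
  by apply: bmf_le_integral => //; exact: bmfD.
by rewrite bmf_integralD// lerD//; near: n.
Unshelve. all: by end_near. Qed.

Let approx_bmf B (f : S -> R) : measurable B -> continuous f -> (forall x, 0 <= f x <= 1) ->
  bmf ((fun x => `|\1_B x - f x|) : borelType S -> R).
Proof.
move=> mB cf f01; apply: bmf_norm; apply: bmfB; last exact: unit_bmf.
exact: bmf_indic.
Qed.

Let approximable_set0 : law_approximable set0.
Proof.
move=> e e0; exists (fun=> 0); split => [x|x|]; [exact: cvg_cst|by rewrite lexx ler01|].
near=> n; under eq_Rintegral do rewrite indic0 subrr normr0.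
by rewrite integral_cst_prob ltW.
Unshelve. all: by end_near. Qed.

Let approximableC B : law_approximable B -> law_approximable (~` B).
Proof.
move=> aB e e0; have [f [cf f01 fB]] := aB e e0.
exists (fun x => 1 - f x); split.
- by move=> x; apply: cvgB; [exact: cvg_cst|exact: cf].
- by move=> x; have /andP[f0 f1] := f01 x; rewrite subr_ge0 f1 gerBl.
- apply: filterS fB => n.
  rewrite (_ : \int[P]_w _ = \int[P]_w `|\1_B (X n w) - f (X n w)|)//.
  apply: eq_Rintegral => w _; rewrite -[in LHS]normrN; congr `|_|.
  by rewrite !indicE in_setC; case: (_ \in B) => /=; ring.
Qed.

Let approximableI B B' : measurable B -> measurable B' ->
  law_approximable B -> law_approximable B' -> law_approximable (B `&` B').
Proof.
move=> mB mB' aB aB' e e0; have e2 : 0 < e / 2 by rewrite divr_gt0.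
have [f [cf f01 fB]] := aB _ e2; have [g [cg g01 gB']] := aB' _ e2.
have cfg : continuous (fun x => f x * g x).
  by move=> x; apply: cvgM; [exact: cf|exact: cg].
have fg01 x : 0 <= f x * g x <= 1.
  have /andP[f0 f1] := f01 x; have /andP[g0 g1] := g01 x.
  by rewrite mulr_ge0//= mulr_ile1.
exists (fun x => f x * g x); split => //; rewrite [e]splitr.
have b := approx_bmf (measurableI _ _ mB mB') cfg fg01.
apply: (near_le_sum b (approx_bmf mB cf f01) (approx_bmf mB' cg g01) _ fB gB').
move=> x; rewrite -indicM.
(* Both cofactors in this telescoping are bounded by 1, so the two errors simply add. *)
have -> : \1_B x * \1_B' x - f x * g x = (\1_B x - f x) * \1_B' x + f x * (\1_B' x - g x).
  by ring.
apply: le_trans (ler_normD _ _) _; rewrite !normrM; apply: lerD.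
  rewrite ler_piMr// indicE.
  by case: (x \in B'); rewrite ?normr1 ?normr0.
have /andP[f0 f1] := f01 x.
by rewrite (ger0_norm f0) ler_piMl.
Qed.

Let approximableU B B' : measurable B -> measurable B' ->
  law_approximable B -> law_approximable B' -> law_approximable (B `|` B').
Proof.
move=> mB mB' aB aB'; rewrite -[B `|` B']setCK setCU; apply: approximableC.
by apply: approximableI; [exact: measurableC..|exact: approximableC|exact: approximableC].
Qed.

(** What a finite union [U k] misses decreases to the empty set, so by Nikodym's theorem it has
    small mass at all large times; the approximation of [U k] then serves the whole union. *)
Let approximable_bigcup (B : nat -> set (borelType S)) : (forall i, measurable (B i)) ->
  (forall i, law_approximable (B i)) -> law_approximable (\bigcup_i B i).
Proof.
move=> mB aB.
pose U := fix U k := if k is j.+1 then U j `|` B j else set0.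
have mU k : measurable (U k).
  by elim: k => [|k IH] /=; [exact: measurable0|exact: measurableU].
have aU k : law_approximable (U k).
  by elim: k => [|k IH] /=; [exact: approximable_set0|exact: approximableU].
have UB k : U k `<=` \bigcup_i B i.
  by elim: k => [//|k IH] x /= [/IH//|Bx]; exists k.
pose A k := \bigcup_i B i `\` U k.
have mBB : measurable (\bigcup_i B i) by exact: bigcupT_measurable.
have mA k : measurable (A k) by exact: measurableD.
have AS k : A k.+1 `<=` A k by move=> x [Bx nU]; split => // Ux; apply: nU; left.
have A0 : \bigcap_k A k = set0.
  apply/seteqP; split => // x Ax; have [[i _ Bix] _] := Ax 0%N I.
  by have [_] := Ax i.+1 I; apply; right.
move=> e e0; have e2 : 0 < e / 2 by rewrite divr_gt0.
have [k kA] := nikodym_tail_law mA AS A0 e2.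
have [f [cf f01 fU]] := aU k _ e2.
exists f; split => //; rewrite [e]splitr.
apply: (near_le_sum (approx_bmf mBB cf f01) (approx_bmf (mU k) cf f01)
  (bmf_indic (mA k)) _ fU kA).
move=> x; have -> : \1_(\bigcup_i B i) x = \1_(U k) x + \1_(A k) x :> R.
  rewrite /A !indicE in_setD; have [xU|xU] := boolP (x \in U k).
    by rewrite (mem_set (UB k x (set_mem xU)))/= addr0.
  by rewrite add0r andbT.
rewrite addrAC; apply: le_trans (ler_normD _ _) _.
by rewrite (ger0_norm (_ : 0 <= \1_(A k) x)).
Qed.

Hypothesis cozeroS : cozero_opens R S.

(** The functions [min 1 (k * g)] increase to the indicator of [U] and differ from it only on [A k];
    these sets decrease to the empty set, so Nikodym's theorem applies. *)
Let approximable_open (U : set S) : open U -> law_approximable U.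
Proof.
move=> oU e e0; have [g cg gU] := cozeroS oU.
have mU : measurable (U : set (borelType S)) by exact: sub_sigma_algebra.
pose f k x := Num.min 1 (k%:R * g x).
have ckg k : continuous (fun x => k%:R * g x) by move=> x; apply: cvgMr; exact: cg.
have cf k : continuous (f k).
  by move=> x; apply: (@continuous_min _ _ (fun=> 1) (fun x => k%:R * g x));
    [exact: cvg_cst|exact: ckg].
have f01 k x : 0 <= f k x <= 1.
  by rewrite /f le_min ler01 mulr_ge0 ?ge_min ?lexx//; have [] := gU x.
pose A k : set (borelType S) := U `&` [set x | k%:R * g x < 1].
have mA k : measurable (A k).
  apply: measurableI => //; apply: sub_sigma_algebra.
  move/continuousP : (ckg k) => /(_ `]-oo, 1[%classic).
  by rewrite preimage_itvNyo; apply; exact: interval_open.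
have AS k : A k.+1 `<=` A k.
  move=> x [Ux /= kx]; split => //=; apply: le_lt_trans kx.
  by rewrite ler_wpM2r// ?ler_nat//; have [] := gU x.
have A0 : \bigcap_k A k = set0.
  apply/seteqP; split => // x Ax; have [/(proj2 (gU x)).2 gx _] := Ax 0%N I.
  (* This index exceeds the inverse of [g x], so [x] has left the set [A] by then. *)
  have [_ /=] := Ax (Num.truncn (g x)^-1).+1 I; apply/negP; rewrite -leNgt.
  by rewrite -ler_pdivrMr// mul1r ltW// truncnS_gt.
have [k kA] := nikodym_tail_law mA AS A0 e0.
exists (f k); split => //; apply: filterS kA => n; apply: le_trans.
apply: bmf_le_integral; [exact: probability_setT_lty|..].
- exact: (bmf_obs X n (approx_bmf mU (cf k) (f01 k))).
- exact: (bmf_obs X n (bmf_indic (mA k))).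
move=> w; set x := X n w; rewrite /f !indicE in_setI.
have [/set_mem Ux|Ux] := boolP (x \in U) => /=.
  have g0 := (proj2 (gU x)).2 Ux.
  have [kg|kg] := leP 1 (k%:R * g x); first by rewrite subrr normr0.
  by rewrite mem_set//= ger0_norm ?subr_ge0 ?(ltW kg)// gerBl mulr_ge0// ltW.
have -> : g x = 0.
  have [g0 [gUx _]] := gU x; apply/eqP; rewrite eq_le g0 andbT leNgt; apply/negP => gx.
  by move/negP : Ux; apply; apply/mem_set/gUx.
by rewrite mulr0 min_r// subr0 normr0.
Qed.

Lemma measurable_law_approximable B : measurable B -> law_approximable B.
Proof.
pose G (B : set (borelType S)) := measurable B /\ law_approximable B.
suff : (@measurable _ (borelType S)) `<=` G by move=> h /h[].
apply: smallest_sub; last first.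
  by move=> U oU; split; [exact: sub_sigma_algebra|exact: approximable_open].
split.
- by split; [exact: measurable0|exact: approximable_set0].
- move=> A [mA aA]; rewrite setTD; split; [exact: measurableC|exact: approximableC].
- move=> A GA; split; [apply: bigcupT_measurable|apply: approximable_bigcup] => i;
    by case: (GA i).
Qed.

End Approximation.

(** * The equivalence *)

Section Main.
Context {R : realType} {S : ptopologicalType} {d : measure_display}
  {Omega : measurableType d}.
Variables (P : probability Omega R) (X : nat -> {mfun Omega >-> borelType S})
  (alpha : nat -> R.-pker Omega ~> borelType S).
Hypothesis halpha : predictive P X alpha.
Let Pfin := probability_setT_lty P.

Let al (f : S -> R) n : Omega -> R :=
  random_integral (alpha n : Omega -> {measure set _ -> \bar R}) f.

Lemma bounded_setTP (T : Type) (f : T -> R) :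
  [bounded f x | x in [set: T]] <-> exists M, forall x, `|f x| <= M.
Proof.
split=> [[M [_ fM]]|[M fM]].
  by exists (M + 1) => x; apply: fM => //; rewrite ltrDl.
by exists M; split; [exact: num_real|move=> N MN x _; exact: le_trans (fM x) (ltW MN)].
Qed.

Lemma MbP (f : S -> R) : Mb f <-> bmf (f : borelType S -> R).
Proof. by split=> -[mf /bounded_setTP fM]. Qed.

Lemma cond_expectationE (H : set Omega) (Z : Omega -> R) : measurable H -> bmf Z ->
  cond_expectation P H Z = \int[P]_w (\1_H w * Z w) / fine (P H).
Proof.
move=> mH bZ; rewrite /cond_expectation bmf_expectationE//.
by apply: bmfM => //; exact: bmf_indic.
Qed.

(** The factor 1 is the test variable [Z] with which [predictive_cvg_obs] is applied. *)
Lemma fine_probability_preimage n (B : set (borelType S)) : measurable B ->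
  fine (P (X n @^-1` B)) = \int[P]_w (1 * \1_B (X n w)).
Proof.
move=> mB; have mX : measurable (X n @^-1` B).
  by rewrite -[X in measurable X]setTI; exact: measurable_funP.
by rewrite -(integral_indic_fine P mX); apply: eq_Rintegral => w _; rewrite mul1r.
Qed.

Lemma empirical_mean (f : S -> R) : bmf (f : borelType S -> R) ->
  (fun n => random_integral (empirical X n) f) =
  (fun n w => n%:R^-1 * \sum_(i < n) f (X i w)).
Proof. by move=> bf; apply/funext => n; apply/funext => w; exact: empiricalE. Qed.

Let ba n (f : S -> R) (bf : bmf (f : borelType S -> R)) : bmf (al f n).
Proof. exact: (bmf_predictive halpha n bf). Qed.

Lemma bmf_mean n (f : S -> R) : bmf (f : borelType S -> R) ->
  bmf (fun w => n%:R^-1 * \sum_(i < n) f (X i w)).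
Proof. by move=> bf; apply: bmfZ; apply: bmf_sum => i; exact: (bmf_obs X i bf). Qed.

Lemma expectation_sqrB n (f : S -> R) : bmf (f : borelType S -> R) ->
  'E_P[fun w => (al f n w ^+ 2 - random_integral (empirical X n) f w ^+ 2)%R]%E =
  (\int[P]_w (al f n w ^+ 2 - (n%:R^-1 * \sum_(i < n) f (X i w)) ^+ 2))%:E.
Proof.
move=> bf; rewrite -bmf_expectationE; last first.
  by apply: bmfB; apply: bmfX; [exact: ba|exact: bmf_mean].
by congr expectation; apply/funext => w; rewrite empiricalE.
Qed.

Lemma cvg_L1_of_cvg_prob (f : S -> R) : bmf (f : borelType S -> R) ->
  cvg_in_probability P (al f) -> exists C V, [/\ bmf V, forall x, `|f x| <= C,
    forall w, `|V w| <= C & cvg_L1 P (al f) V].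
Proof.
move=> bf cp; have [C C0 fC] := bmf_bound bf.
have aC n w : `|al f n w| <= C by exact: random_integral_bound.
have [V [bV VC aV]] := cvg_prob_L1 (fun n => ba n bf) aC cp.
by exists C, V.
Qed.

(** * From predictions to observations and empirical means *)

Lemma predictive_necessary :
  (forall f : S -> R, Mb f -> cvg_in_probability P (al f)) ->
  (forall B : set (borelType S), measurable B -> cvgn (fun n => fine (P (X n @^-1` B)))) /\
  (forall (f : S -> R) (H : set Omega), Cb f -> measurable H -> (0 < P H)%E ->
    [/\ cvgn (fun n => cond_expectation P H (f \o X n)),
        cvg_in_probability P (fun n => random_integral (empirical X n) f)
      & 'E_P[fun w => (al f n w ^+ 2 - random_integral (empirical X n) f w ^+ 2)%R]%E
          @[n --> \oo] --> 0%E]).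
Proof.
move=> ha; split.
  move=> B mB; have bB := @bmf_indic _ _ R _ mB.
  have [C [V [bV _ _ aV]]] := cvg_L1_of_cvg_prob bB (ha _ ((MbP _).2 bB)).
  under eq_fun do rewrite fine_probability_preimage//.
  apply: cvgP; exact: (predictive_cvg_obs halpha bB bV (bmf_cst 1) aV).
move=> f H [cf /bounded_setTP[M fM]] mH PH.
have bf := continuous_bmf cf fM.
have [C [V [bV fC VC aV]]] := cvg_L1_of_cvg_prob bf (ha _ ((MbP _).2 bf)).
have meanV := predictive_cvg_mean halpha bf bV aV.
have MC n w := mean_bound n (fun i => fC (X i w)).
have aC n w : `|al f n w| <= C by exact: random_integral_bound.
split.
- have bX n : bmf (f \o X n) by exact: (bmf_obs X n bf).
  under eq_fun do rewrite (cond_expectationE mH (bX _)).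
  apply: is_cvgMl; apply: cvgP.
  exact: (predictive_cvg_obs halpha bf bV (bmf_indic mH) aV).
- rewrite empirical_mean//; apply: cvg_L1_prob bV meanV => n; exact: bmf_mean.
- under eq_fun do rewrite expectation_sqrB//.
  apply: cvg_EFin; first by near=> n.
  have l1 := cvg_L1_sqr (fun n => ba n bf) bV aC VC aV.
  have l2 := cvg_L1_sqr (fun n => bmf_mean n bf) bV MC VC meanV.
  rewrite (_ : _ \o _ = fun n => \int[P]_w (al f n w ^+ 2) -
    \int[P]_w ((n%:R^-1 * \sum_(i < n) f (X i w)) ^+ 2)); last first.
    apply/funext => n /=.
    by rewrite (bmf_integralB Pfin (bmfX 2 (ba n bf)) (bmfX 2 (bmf_mean n bf))).
  by have := cvgB l1 l2; rewrite subrr; apply.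
Unshelve. all: by end_near. Qed.

(** * From continuous functions to all bounded measurable ones *)

Section Sufficient.
Hypothesis cvgX : forall B : set (borelType S), measurable B ->
  cvgn (fun n => fine (P (X n @^-1` B))).
Hypothesis hCb : forall (f : S -> R) (H : set Omega), Cb f -> measurable H -> (0 < P H)%E ->
    [/\ cvgn (fun n => cond_expectation P H (f \o X n)),
        cvg_in_probability P (fun n => random_integral (empirical X n) f)
      & 'E_P[fun w => (al f n w ^+ 2 - random_integral (empirical X n) f w ^+ 2)%R]%E
          @[n --> \oo] --> 0%E].

Let L1_limit (f : borelType S -> R) := exists2 V, bmf V & cvg_L1 P (al f) V.

Lemma continuous_L1_limit (f : S -> R) M : continuous f -> (forall x, `|f x| <= M) ->
  L1_limit f.
Proof.
move=> cf fM; have Cf : Cb f by split => //; apply/bounded_setTP; exists M.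
have bf := continuous_bmf cf fM.
have P1 : (0 < P [set: Omega])%E by rewrite probability_setT lte01.
(* Two of the three conditions do not involve the event, so they are read off at the sure event. *)
have [_ pmean sq] := hCb Cf measurableT P1.
rewrite empirical_mean// in pmean.
have MC n w := mean_bound n (fun i => fM (X i w)).
have [V [bV VM meanV]] := cvg_prob_L1 (fun n => bmf_mean n bf) MC pmean.
exists V => //; apply: (cvg_L1_predictive halpha bf bV fM VM meanV).
- move=> H mH; have bH := @bmf_indic _ _ R _ mH.
  (* The assumption concerns events of positive probability only; over a null event the integrals
     all vanish. *)
  have [PH|PH] := ltP 0%E (P H); last first.
    have PH0 : fine (P H) = 0.
      by have -> : P H = 0%E by apply/eqP; rewrite eq_le PH measure_ge0.
    rewrite (_ : (fun n => _) = fun=> 0); first exact: is_cvg_cst.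
    apply/funext => n; have bX := bmfM bH (bmf_obs X n bf).
    apply/eqP; rewrite -normr_le0; apply: le_trans (bmf_le_norm_integral Pfin bX) _.
    rewrite -(mulr0 M) -PH0 -(integral_indic_fine P mH) -(bmf_integralZ Pfin _ bH).
    apply: bmf_le_integral => //; [exact: bmf_norm|exact: bmfZ|].
    by move=> w; rewrite normrM mulrC (ger0_norm (_ : 0 <= \1_H w))// ler_wpM2r.
  have [h _ _] := hCb Cf mH PH.
  have PH0 : fine (P H) != 0 by rewrite gt_eqF// fine_gt0// PH -ge0_fin_numE// fin_num_measure.
  rewrite (_ : (fun n => _) = fun n => fine (P H) * cond_expectation P H (f \o X n)).
    exact: is_cvgMr.
  have bX n : bmf (f \o X n) by exact: (bmf_obs X n bf).
  apply/funext => n; rewrite (cond_expectationE mH (bX _)).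
  by rewrite mulrCA divff// mulr1.
- have {}sq : (fun n => (\int[P]_w (al f n w ^+ 2
      - (n%:R^-1 * \sum_(i < n) f (X i w)) ^+ 2))%:E) @ \oo --> 0%E.
    by rewrite (_ : (fun n => _) = (fun n => 'E_P[fun w => (al f n w ^+ 2
      - random_integral (empirical X n) f w ^+ 2)%R]%E))//; apply/funext => n;
      rewrite expectation_sqrB.
  exact: (fine_cvg sq).
Qed.

(** Having an L1 limit is stable under linear combinations and uniform limits. For an indicator,
    [measurable_law_approximable] supplies a continuous function whose predictions are L1-close by
    contraction, and completeness concludes. *)
Lemma Mb_L1_limit : cozero_opens R S -> forall f : S -> R, Mb f -> L1_limit f.
Proof.
move=> cozS f /MbP bf; move: f bf; apply: (@bmf_ind _ (borelType S) R L1_limit).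
- move=> B mB; have bB := @bmf_indic _ _ R _ mB; have [C C0 BC] := bmf_bound bB.
  apply: (L1_complete_approx (fun n => ba n bB)) => [n w|e e0].
    exact: random_integral_bound.
  have [f [cf f01 fB]] := measurable_law_approximable cvgX cozS mB e0.
  have f1 x : `|f x| <= 1 by have /andP[? ?] := f01 x; rewrite ger0_norm.
  have bf := continuous_bmf cf f1.
  have [V bV fV] := continuous_L1_limit cf f1.
  exists (al f), V; split => //; first by move=> n; exact: ba.
  apply: filterS fB => n; apply: le_trans; exact: integral_predictive_dist.
- move=> a f g bf bg [V bV fV] [W bW gW].
  exists (fun w => a * V w + W w); first by apply: bmfD => //; exact: bmfZ.
  have -> : al (fun x => a * f x + g x) = fun n w => a * al f n w + al g n w.
    by apply/funext => n; apply/funext => w; exact: random_integral_lin.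
  apply: cvg_L1D => //.
  + by move=> n; apply: bmfZ; exact: ba.
  + exact: bmfZ.
  + by move=> n; exact: ba.
  + by apply: cvg_L1Z => // n; exact: ba.
- move=> f bf approx; have [C C0 fC] := bmf_bound bf.
  apply: (L1_complete_approx (fun n => ba n bf)) => [n w|e e0].
    exact: random_integral_bound.
  have [g [bg [V bV gV] fg]] := approx _ e0.
  exists (al g), V; split => //; first by move=> n; exact: ba.
  near=> n; apply: le_trans (integral_predictive_dist halpha n bf bg) _.
  rewrite -[leRHS](integral_cst_prob P); apply: bmf_le_integral => //.
  + by apply: bmf_norm; apply: bmfB; [exact: (bmf_obs X n bf)|exact: (bmf_obs X n bg)].
  + exact: bmf_cst.
Unshelve. all: by end_near. Qed.

End Sufficient.

End Main.

Theorem theorem5 (R : realType) (S : ptopologicalType)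
    (hS : standard_borel R S)
    (d : measure_display) (Omega : measurableType d) (P : probability Omega R)
    (X : nat -> {mfun Omega >-> borelType S})
    (alpha : nat -> R.-pker Omega ~> borelType S)
    (halpha : predictive P X alpha) :
  (forall f : S -> R, Mb f ->
     cvg_in_probability P (fun n => random_integral (alpha n) f))
  <->
  ((forall B : set (borelType S), measurable B ->
      cvgn (fun n => fine (P (X n @^-1` B)))) /\
   (forall (f : S -> R) (H : set Omega),
      Cb f -> measurable H -> (0 < P H)%E ->
      [/\ cvgn (fun n => cond_expectation P H (f \o X n)),
          cvg_in_probability P (fun n => random_integral (empirical X n) f)
        & 'E_P[fun w => (random_integral (alpha n) f w ^+ 2
                         - random_integral (empirical X n) f w ^+ 2)%R]%E
            @[n --> \oo] --> 0%E])).
Proof.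
split; first exact: predictive_necessary.
move=> [cvgX hCb] f Mf.
have [V bV fV] := Mb_L1_limit halpha cvgX hCb (standard_borel_cozero hS) Mf.
by apply: cvg_L1_prob bV fV => n; apply: (bmf_predictive halpha n); exact/MbP.
Qed.
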